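(* Let $\gamma=(x,y)$ be a smooth curve in the affine plane with strictly positive equi-affine curvature. Then $\gamma$ is a critical point of the full-affine arc-length $\int\sqrt{\kappa}\,\mathrm{d}s$ (among strictly positively curved curves, with respect to compactly supported variations) if and only if either $\gamma$ is a full-affine W-curve (its full-affine curvature $\kappa_{\mathbf F}$ is constant), or, for a suitable choice of origin of the coordinates $(x,y)$, the full-affine curvature is a non-zero linear function of the position vector: $\kappa_{\mathbf F}=A\,x+B\,y$ with $(A,B)\neq(0,0)$.
   Context: The affine plane is $\mathbb{R}^2$ with area form $|u,v|=\det(u,v)$. The curve is parametrised by equi-affine arc-length $s$, i.e. $|\gamma',\gamma''|=1$; primes denote $s$-derivatives; the equi-affine curvature $\kappa$ is defined by $\gamma'''=-\kappa\gamma'$, and strictly positively curved means $\kappa>0$. The full-affine arc-length element is $\mathrm{d}s_{\mathbf F}=\sqrt{\kappa}\,\mathrm{d}s$ and the full-affine curvature is $\kappa_{\mathbf F}=\dfrac{\kappa'}{2\kappa^{3/2}}$. A full-affine W-curve is a curve with constant full-affine curvature. Critical point means the first variation of the functional vanishes for all smooth compactly supported variations. *)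

(* Defs.v *)
From HB Require Import structures.
From mathcomp Require Import all_boot all_order all_algebra.
From mathcomp Require Import all_classical all_reals all_analysis.
Set Implicit Arguments. Unset Strict Implicit. Unset Printing Implicit Defensive.
Import Order.TTheory GRing.Theory Num.Theory.
Import numFieldNormedType.Exports.
Local Open Scope classical_set_scope.
Local Open Scope ring_scope.

Section AffineCurves.
Variable R : realType.

Definition smooth_on (I : set R) (f : R -> R) : Prop :=
  forall (n : nat) (t : R), I t -> derivable (derive1n n f) t 1.

Definition adet (x y : R -> R) : R -> R :=
  fun u => derive1 x u * derive1n 2 y u - derive1 y u * derive1n 2 x u.

(* derivative with respect to equi-affine arc-length s:
   d/ds = (|c',c''|)^(-1/3) d/du *)
Definition sD (phi : R -> R) (f : R -> R) : R -> R :=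
  fun u => derive1 f u / (phi u `^ (3%:R)^-1).

(* equi-affine curvature kappa = |c_ss, c_sss| (since c_sss = - kappa c_s
   and |c_s, c_ss| = 1), computed in an arbitrary parametrization *)
Definition ea_kappa (x y : R -> R) : R -> R :=
  let phi := adet x y in
  let x2 := sD phi (sD phi x) in
  let y2 := sD phi (sD phi y) in
  fun u => x2 u * sD phi y2 u - y2 u * sD phi x2 u.

(* integrand of the full-affine arc-length  sqrt(kappa) ds,
   with ds = |c',c''|^(1/3) du *)
Definition fa_element (x y : R -> R) : R -> R :=
  fun u => Num.sqrt (ea_kappa x y u) * (adet x y u `^ (3%:R)^-1).

Definition fa_curv (x y : R -> R) : R -> R :=
  let k := ea_kappa x y in
  fun u => sD (adet x y) k u / (2%:R * (k u `^ (3%:R / 2%:R))).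

Definition fa_length (x y : R -> R) (c d : R) : R :=
  Rintegral (@lebesgue_measure R) `[c, d] (fa_element x y).

End AffineCurves.

(* Main.v *)
(* Write [i, j] for the determinant of the i-th and j-th derivatives of the
   curve.  In any parametrization the squared full-affine element is the rational
   expression
     kappa |c',c''|^(2/3) = (4/3 [2,3] + 1/3 [1,4]) / [1,2] - 5/9 ([1,3] / [1,2])^2,
   so the first variation of the length at an equi-affinely parametrized curve
   can be read off a second order expansion in t.  With w = 1 / (2 sqrt kappa)
   and eta the variation field, its density differs from
   (w'''' + kappa w'') |gamma', eta| / 3 by the derivative of a function supported
   in [c, d].  Testing with a bump function times (w'''' + kappa w'') gamma'', the
   Euler-Lagrange equation is w'''' + kappa w'' = 0.  Now w' = - kappa_F / 2, and
   z'' = - kappa z is the equation solved by x' and y', whose Wronskian is 1; hence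
   criticality means that kappa_F' is a combination of x' and y' with constant
   coefficients. *)
Require Import Defs.
From HB Require Import structures.
From mathcomp Require Import all_boot all_order all_algebra.
From mathcomp Require Import all_classical all_reals all_analysis.
From mathcomp Require Import ring lra.
Set Implicit Arguments.
Unset Strict Implicit.
Unset Printing Implicit Defensive.
Import Order.TTheory GRing.Theory Num.Theory.
Import numFieldNormedType.Exports.
Local Open Scope classical_set_scope.
Local Open Scope ring_scope.

(* In [ring_scope] these notations would denote the derivative of a polynomial. *)
Local Notation "f ^` ()" := (derive1 f) : ring_scope.
Local Notation "f ^` ( n )" := (derive1n n f) : ring_scope.

(** * Smooth functions on an open set *)

Section SmoothFunctions.
Context {R : realType}.
Implicit Types (I : set R) (f g : R -> R) (u a b c : R).

Lemma is_derive_lamD f g u a b : is_derive u 1 f a -> is_derive u 1 g b ->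
  is_derive u 1 (fun v => f v + g v) (a + b).
Proof. exact: is_deriveD. Qed.

Lemma is_derive_lamB f g u a b : is_derive u 1 f a -> is_derive u 1 g b ->
  is_derive u 1 (fun v => f v - g v) (a - b).
Proof. exact: is_deriveB. Qed.

Lemma is_derive_lamN f u a : is_derive u 1 f a ->
  is_derive u 1 (fun v => - f v) (- a).
Proof. exact: is_deriveN. Qed.

Lemma is_derive_lamM f g u a b : is_derive u 1 f a -> is_derive u 1 g b ->
  is_derive u 1 (fun v => f v * g v) (a * g u + f u * b).
Proof.
move=> hf hg; rewrite addrC (mulrC a); exact: is_deriveM.
Qed.

Lemma is_derive_lamV f u a : f u != 0 -> is_derive u 1 f a ->
  is_derive u 1 (fun v => (f v)^-1) (- a * (f u)^-1 * (f u)^-1).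
Proof.
move=> fu0 hf; rewrite (_ : _ * _ = - (f u) ^- 2 *: a); first exact: is_deriveV.
by rewrite /GRing.scale /= expr2 invfM; ring.
Qed.

Lemma is_derive_lam_powR f u a r : 0 < f u -> is_derive u 1 f a ->
  is_derive u 1 (fun v => f v `^ r) (a * (r * f u `^ (r - 1))).
Proof.
move=> fu0 hf; rewrite mulrC.
exact: (is_derive1_comp (f := fun x => x `^ r) (is_derive1_powR r fu0)).
Qed.

Lemma is_derive_derive1 f u a : is_derive u 1 f a -> f^`() u = a.
Proof. by move=> hf; rewrite derive1E derive_val. Qed.

Lemma is_derive_congr f u a b : is_derive u 1 f a -> a = b -> is_derive u 1 f b.
Proof. by move=> h <-. Qed.

Lemma derivable_is_derive1 f u : derivable f u 1 -> is_derive u 1 f (f^`() u).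
Proof. by move=> /derivableP; rewrite derive1E. Qed.

Lemma open_near_eq I f g u : open I -> (forall v, I v -> f v = g v) -> I u ->
  {near u, f =1 g}.
Proof.
move=> oI fg Iu; have : nbhs u I by exact: open_nbhs_nbhs.
by apply: filterS => v /fg.
Qed.

Lemma derive1_ext_open I f g : open I -> (forall v, I v -> f v = g v) ->
  forall u, I u -> f^`() u = g^`() u.
Proof.
move=> oI fg u Iu; rewrite !derive1E; apply: near_eq_derive => //.
exact: open_near_eq fg Iu.
Qed.

Lemma derivable_ext_open I f g u : open I -> (forall v, I v -> f v = g v) ->
  I u -> derivable f u 1 -> derivable g u 1.
Proof. by move=> oI fg Iu; apply: near_eq_derivable; exact: open_near_eq fg Iu. Qed.

Lemma derive1n_ext_open I f g n : open I -> (forall v, I v -> f v = g v) ->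
  forall u, I u -> f^`(n) u = g^`(n) u.
Proof.
move=> oI; elim: n f g => [|n IHn] f g fg u Iu; first exact: fg.
by rewrite !derive1Sn; apply: IHn => // v Iv; exact: derive1_ext_open fg _ Iv.
Qed.

Lemma smooth_on_ext I f g : open I -> (forall v, I v -> f v = g v) ->
  smooth_on I f -> smooth_on I g.
Proof.
move=> oI fg sf n u Iu; apply: (@derivable_ext_open I f^`(n)) => //; last exact: sf.
by move=> v Iv; exact: derive1n_ext_open fg _ Iv.
Qed.

Lemma smooth_on_sub I (J : set R) f : J `<=` I -> smooth_on I f -> smooth_on J f.
Proof. by move=> JI sf n u /JI; exact: sf. Qed.

Lemma smooth_on_derive1 I f : smooth_on I f -> smooth_on I f^`().
Proof. by move=> sf n u Iu; rewrite -derive1Sn; exact: sf. Qed.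

Lemma smooth_on_derive1n I f n : smooth_on I f -> smooth_on I f^`(n).
Proof.
move=> sf; elim: n => [|n IHn]; first exact: sf.
by rewrite derive1nS; exact: smooth_on_derive1.
Qed.

Lemma smooth_on_is_derive I f : smooth_on I f -> forall u, I u ->
  is_derive u 1 f (f^`() u).
Proof. by move=> sf u Iu; apply: derivable_is_derive1; exact: (sf 0%N). Qed.

Lemma smooth_on_continuous I f : smooth_on I f -> forall u, I u ->
  {for u, continuous f}.
Proof.
move=> sf u Iu; apply: differentiable_continuous.
by apply/derivable1_diffP; exact: (sf 0%N).
Qed.

(** Induction on the order: the higher derivatives of a member of [S] are those of its first
    derivative, which agrees on the open set [I] with another member. *)
Lemma smooth_on_closed_class I (S : (R -> R) -> Prop) : open I ->
  (forall f, S f -> (forall u, I u -> derivable f u 1) /\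
     exists2 g, S g & forall u, I u -> f^`() u = g u) ->
  forall f, S f -> smooth_on I f.
Proof.
move=> oI HS f Sf n; elim: n f Sf => [|n IHn] f /HS[df [g Sg fg]] u Iu.
  exact: df.
rewrite derive1Sn; apply: (@derivable_ext_open I g^`(n)) => //; last exact: IHn.
by move=> v Iv; apply: derive1n_ext_open Iv => // w /fg.
Qed.

(* Closing the smooth functions under the operations below yields a class whose
   members have their derivatives in the class again, so nothing new is added. *)
Inductive smooth_closure I : (R -> R) -> Prop :=
| smooth_closure_base f : smooth_on I f -> smooth_closure I f
| smooth_closure_cst c : smooth_closure I (fun=> c)
| smooth_closureD f g : smooth_closure I f -> smooth_closure I g ->
    smooth_closure I (fun u => f u + g u)
| smooth_closureM f g : smooth_closure I f -> smooth_closure I g ->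
    smooth_closure I (fun u => f u * g u)
| smooth_closureV f : smooth_closure I f -> (forall u, I u -> f u != 0) ->
    smooth_closure I (fun u => (f u)^-1)
| smooth_closure_powR f r : smooth_closure I f -> (forall u, I u -> 0 < f u) ->
    smooth_closure I (fun u => f u `^ r).

Lemma smooth_closureP I : open I -> forall f, smooth_closure I f ->
  (forall u, I u -> derivable f u 1) /\
  exists2 g, smooth_closure I g & forall u, I u -> f^`() u = g u.
Proof.
move=> oI f; suff : smooth_closure I f -> exists2 g, smooth_closure I g &
    forall u, I u -> is_derive u 1 f (g u).
  move=> H /H[g Sg fg]; split => [u /fg|]; first by case.
  by exists g => // u /fg; exact: is_derive_derive1.
elim=> {f} [f sf|c|f g _ [f' Sf df] _ [g' Sg dg]|f g cf [f' Sf df] cg [g' Sg dg]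
  |f cf [f' Sf df] f0|f r cf [f' Sf df] f0].
- exists f^`(); first exact/smooth_closure_base/smooth_on_derive1.
  exact: smooth_on_is_derive.
- exists (fun=> 0); first exact: smooth_closure_cst.
  by move=> u _; exact: is_derive_cst.
- exists (fun u => f' u + g' u); first exact: smooth_closureD.
  by move=> u Iu; apply: is_derive_lamD; [exact: df|exact: dg].
- exists (fun u => f' u * g u + f u * g' u).
    by apply: smooth_closureD; apply: smooth_closureM.
  by move=> u Iu; apply: is_derive_lamM; [exact: df|exact: dg].
- exists (fun u => - 1 * f' u * (f u)^-1 * (f u)^-1).
    do !apply: smooth_closureM => //; try exact: smooth_closureV.
    exact: smooth_closure_cst.
  by move=> u Iu; rewrite mulN1r; apply: is_derive_lamV; [exact: f0|exact: df].
(* The exponent of a power may be any real, so exponent [r - 1] stays in the closure. *)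
- exists (fun u => f' u * (r * f u `^ (r - 1))).
    do !apply: smooth_closureM => //; last exact: smooth_closure_powR.
    exact: smooth_closure_cst.
  by move=> u Iu; apply: is_derive_lam_powR; [exact: f0|exact: df].
Qed.

Lemma smooth_closure_smooth I f : open I -> smooth_closure I f -> smooth_on I f.
Proof.
by move=> oI; apply: smooth_on_closed_class => //; exact: smooth_closureP.
Qed.

Lemma smooth_on_cst I c : open I -> smooth_on I (fun=> c).
Proof.
by move=> oI; apply: smooth_closure_smooth => //; exact: smooth_closure_cst.
Qed.

Lemma smooth_onD I f g : open I -> smooth_on I f -> smooth_on I g ->
  smooth_on I (fun u => f u + g u).
Proof.
move=> oI sf sg; apply: smooth_closure_smooth => //.
by apply: smooth_closureD; exact: smooth_closure_base.
Qed.

Lemma smooth_onM I f g : open I -> smooth_on I f -> smooth_on I g ->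
  smooth_on I (fun u => f u * g u).
Proof.
move=> oI sf sg; apply: smooth_closure_smooth => //.
by apply: smooth_closureM; exact: smooth_closure_base.
Qed.

Lemma smooth_onN I f : open I -> smooth_on I f -> smooth_on I (fun u => - f u).
Proof.
move=> oI sf.
have := smooth_onM oI (smooth_on_cst (c := - 1) oI) sf.
apply: (smooth_on_ext oI).
by move=> u _; rewrite mulN1r.
Qed.

Lemma smooth_onV I f : open I -> smooth_on I f -> (forall u, I u -> f u != 0) ->
  smooth_on I (fun u => (f u)^-1).
Proof.
move=> oI sf f0; apply: smooth_closure_smooth => //.
by apply: smooth_closureV => //; exact: smooth_closure_base.
Qed.

Lemma smooth_on_powR I f r : open I -> smooth_on I f -> (forall u, I u -> 0 < f u) ->
  smooth_on I (fun u => f u `^ r).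
Proof.
move=> oI sf f0; apply: smooth_closure_smooth => //.
by apply: smooth_closure_powR => //; exact: smooth_closure_base.
Qed.

Lemma smooth_on_sqrt I f : open I -> smooth_on I f -> (forall u, I u -> 0 < f u) ->
  smooth_on I (fun u => Num.sqrt (f u)).
Proof.
move=> oI sf f0; apply: smooth_on_ext oI _ (smooth_on_powR (r := 2^-1) oI sf f0).
by move=> u Iu; rewrite powR12_sqrt // ltW // f0.
Qed.

End SmoothFunctions.

(** A difference is matched as the sum [f + - g]. Inverses and roots of non-constant functions are
    not decomposed; their smoothness must be a hypothesis. *)
Ltac smooth := lazymatch goal with
  | |- smooth_on _ (fun _ => ?c) =>
      notypeclasses refine (@smooth_on_cst _ _ c _); assumption
  | |- smooth_on _ (fun u => @?f u + @?g u) =>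
      notypeclasses refine (@smooth_onD _ _ f g _ _ _);
      [assumption | smooth | smooth]
  | |- smooth_on _ (fun u => @?f u * @?g u) =>
      notypeclasses refine (@smooth_onM _ _ f g _ _ _);
      [assumption | smooth | smooth]
  | |- smooth_on _ (fun u => - @?f u) =>
      notypeclasses refine (@smooth_onN _ _ f _ _); [assumption | smooth]
  | |- smooth_on ?I (fun u => ?f u) => change_no_check (smooth_on I f); smooth
  | |- smooth_on _ (derive1 _) =>
      notypeclasses refine (smooth_on_derive1 _); smooth
  | |- smooth_on _ (derive1n _ _) =>
      notypeclasses refine (smooth_on_derive1n _); smooth
  | |- smooth_on _ ?f =>
      multimatch goal with H : smooth_on _ ?g |- _ => constr_eq f g; exact H end
  end.

(* Plain [refine] and [apply:] would run typeclass resolution on [is_derive]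
   premises, whose instances do not terminate quickly here. *)
Ltac deriv := lazymatch goal with
  | |- is_derive _ _ (fun _ => ?c) _ => exact: is_derive_cst
  | |- is_derive _ _ (fun u => @?f u - @?g u) _ =>
      notypeclasses refine (@is_derive_lamB _ f g _ _ _ _ _); deriv
  | |- is_derive _ _ (fun u => @?f u + @?g u) _ =>
      notypeclasses refine (@is_derive_lamD _ f g _ _ _ _ _); deriv
  | |- is_derive _ _ (fun u => @?f u * @?g u) _ =>
      notypeclasses refine (@is_derive_lamM _ f g _ _ _ _ _); deriv
  | |- is_derive _ _ (fun u => - @?f u) _ =>
      notypeclasses refine (@is_derive_lamN _ f _ _ _); deriv
  | |- is_derive ?x ?v (fun u => ?f u) ?d =>
      change_no_check (is_derive x v f d); deriv
  | Iu : ?I ?u |- is_derive ?u _ (derive1 _) _ =>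
      notypeclasses refine (smooth_on_is_derive (I := I) _ Iu); smooth
  | |- is_derive ?u _ ?f _ => first
    [ multimatch goal with H : is_derive u _ ?g _ |- _ => constr_eq f g; exact H end
    | lazymatch goal with Iu : ?I u |- _ =>
        notypeclasses refine (smooth_on_is_derive (I := I) _ Iu); smooth end ]
  end.

Ltac derive_by := notypeclasses refine (is_derive_congr _ _); [deriv|].

Ltac derive1_by := notypeclasses refine (is_derive_derive1 _); derive_by.

(* Comparing values of derivatives up to conversion is very slow, hence they
   are turned into variables before [ring] or [field] sees them. *)
Ltac values u := repeat match goal with
  |- context [?f u] => let x := fresh "x" in generalize (f u); intro x end.

(** * The full-affine element in an arbitrary parametrization *)

Section FullAffineElement.
Context {R : realType}.
Implicit Types (I J : set R) (X Y : R -> R) (u : R).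

(** [bracket 1 2] is convertible to [adet], and the proofs pass freely between the two. *)
Definition bracket (i j : nat) X Y u :=
  X^`(i) u * Y^`(j) u - Y^`(i) u * X^`(j) u.

Lemma smooth_on_bracket J X Y i j : open J -> smooth_on J X -> smooth_on J Y ->
  smooth_on J (bracket i j X Y).
Proof. by move=> oJ sX sY; rewrite /bracket; smooth. Qed.

Lemma is_derive_bracket J X Y i j : smooth_on J X -> smooth_on J Y ->
  forall u, J u -> is_derive u 1 (bracket i j X Y)
    (bracket i.+1 j X Y u + bracket i j.+1 X Y u).
Proof.
move=> sX sY u Ju.
have dX k := smooth_on_is_derive (smooth_on_derive1n (n := k) sX) Ju.
have dY k := smooth_on_is_derive (smooth_on_derive1n (n := k) sY) Ju.
have dXi := dX i; have dXj := dX j; have dYi := dY i; have dYj := dY j.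
rewrite [X in is_derive _ _ _ X](_ : _ =
  X^`(i)^`() u * Y^`(j) u + X^`(i) u * Y^`(j)^`() u -
  (Y^`(i)^`() u * X^`(j) u + Y^`(i) u * X^`(j)^`() u));
  first by rewrite /bracket; deriv.
by rewrite /bracket !derive1nS; ring.
Qed.

(** This is du/ds for the equi-affine arc-length s: [sD (adet X Y)] differentiates in u and
    multiplies by it. *)
Let cbrt_inv X Y u := (adet X Y u `^ 3^-1)^-1.

Lemma smooth_on_cbrt_inv J X Y : open J -> smooth_on J X -> smooth_on J Y ->
  (forall u, J u -> 0 < adet X Y u) -> smooth_on J (cbrt_inv X Y).
Proof.
move=> oJ sX sY pJ; rewrite /cbrt_inv.
have sA : smooth_on J (adet X Y) by exact: (@smooth_on_bracket _ _ _ 1 2).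
apply: (smooth_onV oJ (smooth_on_powR oJ sA pJ)).
by move=> u Ju; rewrite gt_eqF // powR_gt0 // pJ.
Qed.

(** With e = du/ds, the product rule writes the second and third s-derivatives ([s2], [s3]) through
    the first three u-derivatives; their determinant then involves three brackets only. *)
Lemma ea_kappaE J X Y (e := cbrt_inv X Y) : open J ->
  smooth_on J X -> smooth_on J Y -> (forall u, J u -> 0 < adet X Y u) ->
  forall u, J u -> ea_kappa X Y u =
    e u * (e u ^+ 4 * bracket 2 3 X Y u + e u ^+ 3 * e^`() u * bracket 1 3 X Y u +
      (2 * e u ^+ 2 * e^`() u ^+ 2 - e u ^+ 3 * e^`(2) u) * bracket 1 2 X Y u).
Proof.
move=> oJ sX sY pJ u Ju.
have se : smooth_on J e by exact: smooth_on_cbrt_inv.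
pose s2 (Z : R -> R) (v : R) : R := (Z^`(2) v * e v + Z^`(1) v * e^`(1) v) * e v.
pose s3 (Z : R -> R) (v : R) : R := ((Z^`(3) v * e v + Z^`(2) v * e^`(1) v +
   (Z^`(2) v * e^`(1) v + Z^`(1) v * e^`(2) v)) * e v +
   (Z^`(2) v * e v + Z^`(1) v * e^`(1) v) * e^`(1) v) * e v.
have s2P Z : smooth_on J Z ->
    forall v, J v -> sD (adet X Y) (sD (adet X Y) Z) v = s2 Z v.
  move=> sZ v Jv; congr (_ * _).
  have h : is_derive v 1 (fun w => Z^`() w * e w)
    (Z^`()^`() v * e v + Z^`() v * e^`() v) by deriv.
  exact: is_derive_derive1 h.
have s3P Z : smooth_on J Z ->
    sD (adet X Y) (sD (adet X Y) (sD (adet X Y) Z)) u = s3 Z u.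
  move=> sZ; congr (_ * _).
  rewrite (derive1_ext_open oJ (s2P Z sZ) Ju).
  by rewrite /s2; derive1_by.
transitivity (s2 X u * s3 Y u - s2 Y u * s3 X u).
  congr (_ * _ - _ * _); [exact: s2P|exact: s3P|exact: s2P|exact: s3P].
rewrite /s2 /s3 /bracket !derive1n1; values u; ring.
Qed.

(** This polynomial relation, differentiated twice along the curve, is what eliminates the cube root
    in [fa_elementE]. *)
Lemma cbrt_inv_cube X Y u : 0 < adet X Y u ->
  cbrt_inv X Y u ^+ 3 * bracket 1 2 X Y u = 1.
Proof.
move=> p; rewrite /cbrt_inv exprVn -(powR_mulrn 3) ?powR_ge0 // -powRrM mulVf //.
by rewrite powRr1 ?ltW // mulVf // gt_eqF.
Qed.

(** Here e is constantly 1, so its derivatives drop out of [ea_kappaE]. *)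
Lemma ea_kappa_arc I X Y : open I -> smooth_on I X -> smooth_on I Y ->
  (forall u, I u -> adet X Y u = 1) ->
  forall u, I u -> ea_kappa X Y u = bracket 2 3 X Y u.
Proof.
move=> oI sX sY arc u Iu.
have pos v : I v -> 0 < adet X Y v by move=> Iv; rewrite arc.
rewrite (ea_kappaE oI sX sY pos Iu).
have e1 v : I v -> cbrt_inv X Y v = 1.
  by move=> Iv; rewrite /cbrt_inv arc // powR1 invr1.
have ed v : I v -> (cbrt_inv X Y)^`() v = 0.
  by move=> Iv; rewrite (derive1_ext_open oI e1 Iv) derive1_cst.
have -> : (cbrt_inv X Y)^`(2) u = 0.
  rewrite derive1nS derive1n1 (derive1_ext_open oI ed Iu); exact: derive1_cst.
by rewrite (e1 _ Iu) (ed _ Iu); values u; ring.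
Qed.

(** The hypotheses are e^3 [1,2] = 1 and its first two derivatives. Solved for [1,2], [1,3] and
    [1,4], they turn both sides into the same rational function of e, e', e'' and [2,3]. *)
Let rational_element_identity (e e1 e2 w12 w13 w23 w14 : R) : e != 0 ->
  e * e * e * w12 = 1 -> e * e * e * w13 + 3 * (e * e * e1) * w12 = 0 ->
  e ^+ 3 * (w23 + w14) + 6 * e ^+ 2 * e1 * w13 +
    (6 * e * e1 ^+ 2 + 3 * e ^+ 2 * e2) * w12 = 0 ->
  e^-1 ^+ 2 * (e * (e ^+ 4 * w23 + e ^+ 3 * e1 * w13 +
    (2 * e ^+ 2 * e1 ^+ 2 - e ^+ 3 * e2) * w12)) =
  (4 / 3 * w23 + 1 / 3 * w14) / w12 - 5 / 9 * (w13 / w12) ^+ 2.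
Proof.
move=> e0 c0 c1 c2.
have w12E : w12 = e ^- 3.
  by apply: (mulfI (expf_neq0 3 e0)); rewrite mulfV ?expf_neq0// -c0; ring.
have w13E : w13 = - 3 * e1 / e ^+ 4.
  rewrite w12E in c1; apply: (mulfI (expf_neq0 3 e0)).
  by apply/eqP; rewrite -subr_eq0 -[X in _ == X]c1; apply/eqP; field.
have w14E : w14 = - w23 + (12 * e1 ^+ 2 - 3 * e * e2) / e ^+ 5.
  rewrite w12E w13E in c2; apply: (mulfI (expf_neq0 3 e0)).
  by apply/eqP; rewrite -subr_eq0 -[X in _ == X]c2; apply/eqP; field.
by rewrite w12E w13E w14E; field.
Qed.

(** Once e is eliminated, a variation of the curve enters only rationally under the root, which
    makes the expansion in t accessible. *)
Lemma fa_elementE J X Y : open J -> smooth_on J X -> smooth_on J Y ->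
  (forall u, J u -> 0 < adet X Y u) -> forall u, J u ->
  fa_element X Y u = Num.sqrt
    ((4 / 3 * bracket 2 3 X Y u + 1 / 3 * bracket 1 4 X Y u) / bracket 1 2 X Y u
     - 5 / 9 * (bracket 1 3 X Y u / bracket 1 2 X Y u) ^+ 2).
Proof.
move=> oJ sX sY pJ u Ju; set e := cbrt_inv X Y.
have se : smooth_on J e by exact: smooth_on_cbrt_inv.
have e0 : e u != 0 by rewrite invr_eq0 gt_eqF // powR_gt0 // pJ.
have dw i j v : J v -> _ := is_derive_bracket i j sX sY (u := v).
have c0 v : J v -> e v * e v * e v * bracket 1 2 X Y v = 1.
  by move=> Jv; have := cbrt_inv_cube (pJ v Jv); rewrite -/e => <-; values v; ring.
have w22 v : bracket 2 2 X Y v = 0 by rewrite /bracket; values v; ring.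
have c1 v : J v -> e v * e v * e v * bracket 1 3 X Y v
    + 3 * (e v * e v * e^`() v) * bracket 1 2 X Y v = 0.
  move=> Jv; have := derive1_ext_open oJ c0 Jv; rewrite derive1_cst => <-.
  have dv := dw 1%N 2%N v Jv.
  symmetry; derive1_by.
  by rewrite w22; values v; ring.
have c2 : e u ^+ 3 * (bracket 2 3 X Y u + bracket 1 4 X Y u) +
    6 * e u ^+ 2 * e^`() u * bracket 1 3 X Y u +
    (6 * e u * e^`() u ^+ 2 + 3 * e u ^+ 2 * e^`(2) u) * bracket 1 2 X Y u = 0.
  clear c0 e0; clearbody e.
  have := derive1_ext_open oJ c1 Ju; rewrite derive1_cst => <-.
  have dv := dw 1%N 2%N u Ju; have dv' := dw 1%N 3%N u Ju.
  symmetry; derive1_by.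
  by rewrite w22 derive1nS derive1n1; values u; ring.
(* The second factor is nonnegative, so it goes under the root as its square. *)
rewrite /fa_element -[X in _ * X]ger0_norm ?powR_ge0 // -sqrtr_sqr.
rewrite mulrC -sqrtrM ?sqr_ge0 //.
congr Num.sqrt; rewrite (ea_kappaE oJ sX sY pJ Ju) -/e.
have -> : adet X Y u `^ 3^-1 = (e u)^-1 by rewrite /e /cbrt_inv invrK.
move: e0 (c0 u Ju) (c1 u Ju) c2.
by values u; exact: rational_element_identity.
Qed.

Lemma fa_element_continuous J X Y : open J -> smooth_on J X -> smooth_on J Y ->
  (forall u, J u -> 0 < adet X Y u) ->
  forall u, J u -> {for u, continuous (fa_element X Y)}.
Proof.
move=> oJ sX sY pJ u Ju; set e := cbrt_inv X Y.
have se : smooth_on J e by exact: smooth_on_cbrt_inv.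
have sb i j : smooth_on J (bracket i j X Y) by exact: smooth_on_bracket.
have s23 := sb 2%N 3%N; have s13 := sb 1%N 3%N; have s12 := sb 1%N 2%N.
have sk : smooth_on J (ea_kappa X Y).
  (* Powers are spelled out as products, the form that [smooth] decomposes. *)
  apply: (@smooth_on_ext _ _ (fun u => e u * ((e u * e u * (e u * e u)) *
    bracket 2 3 X Y u + e u * e u * e u * e^`() u * bracket 1 3 X Y u +
      (2 * (e u * e u) * (e^`() u * e^`() u) - e u * e u * e u * e^`(2) u) *
        bracket 1 2 X Y u)) _ oJ) => [v Jv|].
    by rewrite (ea_kappaE oJ sX sY pJ Jv) -/e; values v; ring.
  by clearbody e; smooth.
have sr : smooth_on J (fun u => adet X Y u `^ 3^-1) by exact: smooth_on_powR.
(* [Num.sqrt] is continuous on the whole line, so the sign of [ea_kappa] does not matter. *)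
apply: (@continuousM _ _ (Num.sqrt \o ea_kappa X Y) (fun u => adet X Y u `^ 3^-1)).
  apply: continuous_comp; first exact: (smooth_on_continuous sk).
  exact: sqrt_continuous.
exact: (smooth_on_continuous sr).
Qed.

End FullAffineElement.

(** * First variation of the full-affine length *)

Section Expansion.
Context {R : realType}.
Implicit Types (a b c k m s t x y K L G M X Y : R).

Let normD_le x y X Y : `|x| <= X -> `|y| <= Y -> `|x + y| <= X + Y.
Proof. by move=> hx hy; apply: le_trans (ler_normD _ _) (lerD _ _). Qed.

Let normB_le x y X Y : `|x| <= X -> `|y| <= Y -> `|x - y| <= X + Y.
Proof. by move=> hx hy; apply: normD_le => //; rewrite normrN. Qed.

Let normM_le x y X Y : `|x| <= X -> `|y| <= Y -> `|x * y| <= X * Y.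
Proof. by move=> hx hy; rewrite normrM ler_pM. Qed.

(* With Q = s^2 + t L + t^2 G and S = sqrt Q,
   S - s - t L / (2 s) = (t^2 G - (S - s)^2) / (2 s). *)
Lemma sqrt_expansion m K s L G t : 0 < m -> 0 < s -> m <= s ^+ 2 ->
  `|L| <= K -> `|G| <= K -> `|t| <= 1 -> `|t| * (4 * K) <= m ->
  `|Num.sqrt (s ^+ 2 + t * L + t ^+ 2 * G) - s - t * (L / (2 * s))| <=
    (K + 4 * K ^+ 2 / m) / (2 * Num.sqrt m) * t ^+ 2.
Proof.
move=> m0 s0 ms LK GK t1 tK.
have K0 : 0 <= K by exact: le_trans (normr_ge0 _) LK.
set Q := s ^+ 2 + _ + _; set S := Num.sqrt Q.
have LG : `|L + t * G| <= 2 * K.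
  by rewrite (_ : 2 * K = K + 1 * K); [apply: normD_le => //; exact: normM_le|ring].
have Q0 : 0 <= Q.
  have : `|t * (L + t * G)| <= `|t| * (2 * K) by apply: normM_le.
  have : 0 <= `|t| by [].
  rewrite ler_norml => t0 /andP[h _].
  rewrite (_ : Q = s ^+ 2 + t * (L + t * G)); last by rewrite /Q; ring.
  by nra.
have SQ : S ^+ 2 = Q by rewrite sqr_sqrtr.
have S0 : 0 <= S by exact: sqrtr_ge0.
(* S - s is (S^2 - s^2) / (S + s), where (S + s)^2 is at least s^2, hence at least m. *)
have dS : (S - s) ^+ 2 <= 4 * K ^+ 2 / m * t ^+ 2.
  have e1 : (S - s) ^+ 2 * (S + s) ^+ 2 = t ^+ 2 * (L + t * G) ^+ 2.
    rewrite (_ : (S - s) ^+ 2 * _ = (S ^+ 2 - s ^+ 2) ^+ 2); last by ring.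
    by rewrite SQ /Q; ring.
  have e2 : (L + t * G) ^+ 2 <= 4 * K ^+ 2.
    rewrite -(real_normK (num_real _)) (_ : 4 * K ^+ 2 = (2 * K) ^+ 2); last by ring.
    by rewrite ler_pXn2r // nnegrE; lra.
  have e3 : m <= (S + s) ^+ 2 by nra.
  have e4 : (S - s) ^+ 2 * m <= t ^+ 2 * (4 * K ^+ 2).
    apply: (@le_trans _ _ ((S - s) ^+ 2 * (S + s) ^+ 2)).
      by rewrite ler_wpM2l ?sqr_ge0.
    by rewrite e1 ler_wpM2l ?sqr_ge0.
  by rewrite -(ler_pM2r m0) (le_trans e4)// le_eqVlt; apply/orP; left;
    apply/eqP; field; rewrite gt_eqF.
have key : S - s - t * (L / (2 * s)) = (t ^+ 2 * G - (S - s) ^+ 2) / (2 * s).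
  have -> : (S - s) ^+ 2 = Q - 2 * s * S + s ^+ 2 by rewrite -SQ; ring.
  by rewrite /Q; field; rewrite gt_eqF.
have sm : 0 < Num.sqrt m by rewrite sqrtr_gt0.
have sms : Num.sqrt m <= s 
  by rewrite -ler_sqr ?nnegrE ?sqrtr_ge0 ?(ltW s0)// sqr_sqrtr // ltW.
have s2 : `|2 * s| = 2 * s by rewrite ger0_norm //; lra.
rewrite key normrM normfV s2.
rewrite [leRHS]mulrAC; apply: ler_pM => //; first by rewrite invr_ge0; lra.
  rewrite mulrDl; apply: normB_le.
    by rewrite (mulrC (t ^+ 2)); apply: normM_le => //; rewrite ger0_norm ?sqr_ge0.
  by rewrite ger0_norm ?sqr_ge0.
by rewrite lef_pV2 ?posrE; lra.
Qed.

(** The pairs ([a], [b]), ([p], [q]), ([c], [d]) stand for the coefficients of t and t^2 in [1,2],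
    in 4/3 [2,3] + 1/3 [1,4] and in [1,3]. As [r] and [C] depend on [m] and [M] only, the estimate
    will be uniform along a segment of the curve. *)
Lemma element_expansion m M : 0 < m -> 1 <= M -> exists2 r, 0 < r &
  exists C, forall k a b p q c d t, m <= k -> `|k| <= M -> `|a| <= M ->
    `|b| <= M -> `|p| <= M -> `|q| <= M -> `|c| <= M -> `|d| <= M -> `|t| <= r ->
    0 < 1 + t * a + t ^+ 2 * b /\
    `|Num.sqrt ((k + t * p + t ^+ 2 * q) / (1 + t * a + t ^+ 2 * b)
        - 5 / 9 * ((t * c + t ^+ 2 * d) / (1 + t * a + t ^+ 2 * b)) ^+ 2)
      - Num.sqrt k - t * ((p - k * a) / (2 * Num.sqrt k))| <= C * t ^+ 2.
Proof.
move=> m0 M1; pose K := 21 * M ^+ 3.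
have K0 : 0 < K by rewrite mulr_gt0 // exprn_gt0 // (lt_le_trans _ M1).
(* The first bound keeps the denominator above 1/2, the second is the smallness condition of
   [sqrt_expansion]. *)
exists (Num.min (4 * M)^-1 (m / (4 * K))).
  by rewrite lt_min invr_gt0 divr_gt0 //; lra.
exists ((K + 4 * K ^+ 2 / m) / (2 * Num.sqrt m)) =>
  k a b p q c d t mk kM aM bM pM qM cM dM.
rewrite le_min => /andP[tM tK].
have t0 : 0 <= `|t| by [].
have t4 : `|t| * (4 * M) <= 1 by rewrite -ler_pdivlMr ?mul1r//; lra.
have t1 : `|t| <= 1 by nra.
set f := 1 + t * a + t ^+ 2 * b.
have f2 : 1 / 2 <= f.
  have h : `|t * (a + t * b)| <= `|t| * (M + 1 * M).
    by apply: normM_le => //; apply: normD_le => //; apply: normM_le.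
  move: h; rewrite ler_norml => /andP[h _].
  rewrite (_ : f = 1 + t * (a + t * b)); last by rewrite /f; ring.
  by lra.
have f0 : 0 < f by lra.
split => //.
have fV : `|f^-1| <= 2.
  by rewrite ger0_norm ?invr_ge0 ?(ltW f0)// -[2]invrK lef_pV2 ?posrE; lra.
pose L := p - k * a.
have LM : `|L| <= 2 * M ^+ 2.
  apply: le_trans (normB_le pM (normM_le kM aM)) _; nra.
(* With this [G] the radicand is exactly k + t L + t^2 G. *)
pose G := (q - k * b - L * a - t * L * b) / f - 5 / 9 * ((c + t * d) / f) ^+ 2.
have GK : `|G| <= K.
  have h1 : `|(q - k * b - L * a - t * L * b) / f| <=
      (M + M * M + 2 * M ^+ 2 * M + 1 * (2 * M ^+ 2) * M) * 2.
    by do !(apply: normM_le || apply: normB_le) => //.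
  have h2 : `|((c + t * d) / f)| <= (M + 1 * M) * 2.
    by do !(apply: normM_le || apply: normD_le) => //.
  have h3 := normM_le h2 h2.
  have h4 : `|5 / 9 * ((c + t * d) / f) ^+ 2| <=
      5 / 9 * ((M + 1 * M) * 2 * ((M + 1 * M) * 2)).
    by rewrite expr2; apply: normM_le => //; rewrite ger0_norm.
  apply: le_trans (normB_le h1 h4) _; rewrite /K.
  have : M <= M ^+ 2 by nra.
  have : M ^+ 2 <= M ^+ 3 by nra.
  by nra.
have k0 : 0 < k by lra.
have s0 : 0 < Num.sqrt k by rewrite sqrtr_gt0.
have sk : Num.sqrt k ^+ 2 = k by rewrite sqr_sqrtr // ltW.
have LK : `|L| <= K.
  apply: le_trans LM _; rewrite /K.
  have : 0 <= M ^+ 2 by nra.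
  by nra.
have := @sqrt_expansion m K (Num.sqrt k) L G t m0 s0; rewrite sk => H.
have := H mk LK GK t1; rewrite -ler_pdivlMr; last by lra.
move=> /(_ tK); congr (`|Num.sqrt _ - _ - _| <= _).
by rewrite /G /L /f; field; rewrite -/f gt_eqF.
Qed.

End Expansion.

(** * Differentiation under the integral sign, and brackets of a varied curve *)

Section FirstVariation.
Context {R : realType}.
Local Notation mu := (@lebesgue_measure R).
Implicit Types (I : set R) (f g x y xi zeta : R -> R) (c d r t u C : R).

(** A pointwise error C t^2, uniform in u, integrates to at most C (d - c) t^2, so the difference
    quotients at 0 converge to the integral of [g]. *)
Lemma is_derive_Rintegral c d (F : R -> R -> R) g r C : 0 < r -> c <= d ->
  (forall t, `|t| <= r -> mu.-integrable `[c, d] (EFin \o F t)) ->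
  mu.-integrable `[c, d] (EFin \o g) ->
  (forall t u, `|t| <= r -> u \in `[c, d] ->
    `|F t u - F 0 u - t * g u| <= C * t ^+ 2) ->
  is_derive (0 : R) (1 : R) (fun t => Rintegral mu `[c, d] (F t))
    (Rintegral mu `[c, d] g).
Proof.
move=> r0 cd iF ig FC; set L := Rintegral mu _ g.
pose K := C * (d - c).
have bound t : `|t| <= r ->
    `|Rintegral mu `[c, d] (F t) - Rintegral mu `[c, d] (F 0) - t * L| <= K * t ^+ 2.
  move=> tr; have r00 : `|0 : R| <= r by rewrite normr0 ltW.
  have itg : mu.-integrable `[c, d] (EFin \o (fun u => t * g u)).
    have -> : EFin \o (fun u => t * g u) = (fun u => t%:E * (EFin \o g) u)%E by [].
    exact: integrableZl.
  have iFB : mu.-integrable `[c, d] (EFin \o (fun u => F t u - F 0 u)).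
    have -> : EFin \o (fun u => F t u - F 0%R u)%R =
        ((EFin \o F t) \- (EFin \o F 0%R))%E.
      by apply/funext => u; rewrite /= EFinB.
    by apply: integrableB => //; exact: iF.
  have iFBB : mu.-integrable `[c, d] (EFin \o (fun u => F t u - F 0 u - t * g u)).
    have -> : EFin \o (fun u => F t u - F 0%R u - t * g u)%R =
        ((EFin \o (fun u => F t u - F 0%R u)%R) \- (EFin \o (fun u => t * g u)%R))%E.
      by apply/funext => u; rewrite /= EFinB.
    exact: integrableB.
  rewrite -RintegralZl // -RintegralB //; [|exact: iF|exact: iF].
  rewrite -RintegralB //.
  apply: le_trans (le_normr_Rintegral _ _) _ => //.
  have -> : K * t ^+ 2 = Rintegral mu `[c, d] (fun=> C * t ^+ 2).
    rewrite Rintegral_cst //= lebesgue_measure_itv /= lte_fin.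
    rewrite /K; case: ltgtP cd => // [_ _|-> _]; first by rewrite /=; ring.
    by rewrite /= subrr; ring.
  apply: le_Rintegral => //.
  - exact: (integrable_norm iFBB).
  - apply: continuous_compact_integrable; first exact: segment_compact.
    by apply: continuous_subspaceT => ?; exact: cst_continuous.
  - by move=> u ucd; apply: FC.
(* No sign is assumed for [C]; the estimate at t = r, which bounds an absolute value, supplies
   it. *)
have K0 : 0 <= K.
  have h := bound r; rewrite (ger0_norm (ltW r0)) in h; have {}h := h (lexx _).
  by rewrite -(pmulr_lge0 K (exprn_gt0 2 r0)) (le_trans (normr_ge0 _) h).
have lim : (h^-1 *: (Rintegral mu `[c, d] (F (h *: (1 : R) + 0)) -
    Rintegral mu `[c, d] (F 0))) @[h --> 0^'] --> L.
  apply/cvgrPdist_le => /= eps eps0; near=> h.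
  have h0 : h != 0 by near: h; exact: nbhs_dnbhs_neq.
  have hr : `|h| <= r by near: h; apply: dnbhs0_le.
  have he : `|h| <= eps / (K + 1).
    by near: h; apply: dnbhs0_le; rewrite divr_gt0 // ltr_wpDl.
  rewrite /GRing.scale /= mulr1 addr0 distrC.
  have -> : h^-1 * (Rintegral mu `[c, d] (F h) - Rintegral mu `[c, d] (F 0)) - L =
     h^-1 * (Rintegral mu `[c, d] (F h) - Rintegral mu `[c, d] (F 0) - h * L).
    by rewrite [RHS]mulrBr [h^-1 * (h * L)]mulrA mulVf // mul1r.
  rewrite normrM normfV ler_pdivrMl ?normr_gt0 //.
  apply: le_trans (bound h hr) _.
  rewrite -[h ^+ 2]real_normK ?num_real // expr2 mulrCA ler_wpM2l //.
  move: he; rewrite ler_pdivlMr ?ltr_wpDl // => he.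
  by have : 0 <= `|h| by []; nra.
by split; [apply/cvg_ex; exists L | exact: cvg_lim].
Unshelve. all: by end_near. Qed.

Lemma segment_sub I c d : is_interval I -> I c -> I d ->
  forall u, u \in `[c, d] -> I u.
Proof. by move=> iI Ic Id u; rewrite in_itv /= => ucd; exact: (iI c d). Qed.

Lemma continuous_on_segment I f c d : is_interval I -> I c -> I d ->
  (forall u, I u -> {for u, continuous f}) -> {within `[c, d], continuous f}.
Proof.
move=> iI Ic Id cf; apply: continuous_in_subspaceT => u; rewrite inE /= => ucd.
exact/cf/(segment_sub iI Ic Id).
Qed.

Lemma bounded_on_segment f c d : {within `[c, d], continuous f} ->
  exists M, forall u, u \in `[c, d] -> `|f u| <= M.
Proof.
move=> cf; have := continuous_compact cf (@segment_compact _ c d).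
move=> /compact_bounded[M [_ HM]]; exists (M + 1) => u ucd.
by apply: HM; [rewrite ltrDl|exists u].
Qed.

Lemma open_pos I f : open I -> (forall u, I u -> {for u, continuous f}) ->
  open [set u | I u /\ 0 < f u].
Proof.
move=> oI cf; rewrite openE => u [Iu fu]; rewrite /interior.
apply: filterI; first exact: open_nbhs_nbhs.
exact: (cf u Iu [set z | 0 < z] (lt_nbhsr fu)).
Qed.

Lemma derive1n_variation I f g t n : open I -> smooth_on I f -> smooth_on I g ->
  forall u, I u -> (fun v => f v + t * g v)^`(n) u = f^`(n) u + t * g^`(n) u.
Proof.
move=> oI sf sg; elim: n => [//|n IHn] u Iu.
rewrite !derive1nS (derive1_ext_open oI IHn Iu).
derive1_by.
by values u; ring.
Qed.

(** The polarization of [bracket i j]: the coefficient of t in the bracket of the varied curve. *)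
Definition dbracket (i j : nat) x y xi zeta u :=
  x^`(i) u * zeta^`(j) u - y^`(i) u * xi^`(j) u +
  (xi^`(i) u * y^`(j) u - zeta^`(i) u * x^`(j) u).

Lemma bracket_variation I x y xi zeta t i j : open I ->
  smooth_on I x -> smooth_on I y -> smooth_on I xi -> smooth_on I zeta ->
  forall u, I u ->
  bracket i j (fun v => x v + t * xi v) (fun v => y v + t * zeta v) u =
  bracket i j x y u + t * dbracket i j x y xi zeta u +
    t ^+ 2 * bracket i j xi zeta u.
Proof.
move=> oI sx sy sxi szeta u Iu.
rewrite /bracket /dbracket !(derive1n_variation _ _ oI) //.
by values u; ring.
Qed.

End FirstVariation.

(** * The derivative of the length at an equi-affine parametrization *)

Section ArcLengthVariation.
Context {R : realType}.
Local Notation mu := (@lebesgue_measure R).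
Implicit Types (I : set R) (f g x y xi zeta : R -> R) (c d r t u C : R).

(** Since [2,2] = 0, the derivative of the constant [1,2] is [1,3]. *)
Lemma bracket_arc13 I x y : open I -> smooth_on I x -> smooth_on I y ->
  (forall u, I u -> adet x y u = 1) -> forall u, I u -> bracket 1 3 x y u = 0.
Proof.
move=> oI sx sy arc u Iu.
have := is_derive_derive1 (is_derive_bracket 1 2 sx sy Iu).
have -> : (bracket 1 2 x y)^`() u = 0.
  by rewrite (derive1_ext_open oI arc Iu) derive1_cst.
by move=> /esym <-; rewrite /bracket; values u; ring.
Qed.

(** The derivative of [1,3] = 0 is [2,3] + [1,4]. *)
Lemma bracket_arc14 I x y : open I -> smooth_on I x -> smooth_on I y ->
  (forall u, I u -> adet x y u = 1) ->
  forall u, I u -> bracket 1 4 x y u = - bracket 2 3 x y u.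
Proof.
move=> oI sx sy arc u Iu.
have := is_derive_derive1 (is_derive_bracket 1 3 sx sy Iu).
rewrite (derive1_ext_open oI (bracket_arc13 oI sx sy arc) Iu) derive1_cst => h.
by apply/eqP; rewrite -subr_eq0 opprK addrC; apply/eqP.
Qed.

(* The t-derivative at 0 of the square root of the rational expression in
   [fa_elementE], using [1,2] = 1, [1,3] = 0 and [1,4] = - [2,3] = - kappa. *)
Definition variation_density x y xi zeta u :=
  (4 / 3 * dbracket 2 3 x y xi zeta u + 1 / 3 * dbracket 1 4 x y xi zeta u
    - bracket 2 3 x y u * dbracket 1 2 x y xi zeta u) /
  (2 * Num.sqrt (bracket 2 3 x y u)).

Lemma smooth_on_half_sqrtV I f : open I -> smooth_on I f ->
  (forall u, I u -> 0 < f u) -> smooth_on I (fun u => (2 * Num.sqrt (f u))^-1).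
Proof.
move=> oI sf f0; have ss := smooth_on_sqrt oI sf f0.
apply: (smooth_onV oI) => [|u Iu]; first by smooth.
by rewrite mulf_neq0 // gt_eqF // sqrtr_gt0 f0.
Qed.

Lemma smooth_on_variation_density I x y xi zeta : open I ->
  smooth_on I x -> smooth_on I y -> smooth_on I xi -> smooth_on I zeta ->
  (forall u, I u -> 0 < bracket 2 3 x y u) ->
  smooth_on I (variation_density x y xi zeta).
Proof.
move=> oI sx sy sxi szeta pos.
have sb i j : smooth_on I (bracket i j x y) by exact: smooth_on_bracket.
have sw := smooth_on_half_sqrtV oI (sb 2%N 3%N) pos.
have sk := sb 2%N 3%N.
by rewrite /variation_density /dbracket; smooth.
Qed.

(** Because |z| is at most 1 + z^2, bounding one continuous sum of squares bounds seven functions at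
    once. *)
Let norms_le (z1 z2 z3 z4 z5 z6 z7 M : R) :
  z1 * z1 + z2 * z2 + z3 * z3 + z4 * z4 + z5 * z5 + z6 * z6 + z7 * z7 <= M ->
  [/\ `|z1| <= 1 + M, `|z2| <= 1 + M, `|z3| <= 1 + M & `|z4| <= 1 + M] /\
  [/\ `|z5| <= 1 + M, `|z6| <= 1 + M & `|z7| <= 1 + M].
Proof.
have sq (z : R) : 0 <= z * z by rewrite -expr2 sqr_ge0.
have n (z : R) : `|z| <= 1 + z * z by rewrite ler_norml; apply/andP; split; nra.
move: (sq z1) (sq z2) (sq z3) (sq z4) (sq z5) (sq z6) (sq z7).
move: (n z1) (n z2) (n z3) (n z4) (n z5) (n z6) (n z7).
move: (z1 * z1) (z2 * z2) (z3 * z3) (z4 * z4) (z5 * z5) (z6 * z6) (z7 * z7).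
by move=> *; split; split; lra.
Qed.

(** On the compact segment the curvature has a positive minimum and all coefficients are bounded, so
    [element_expansion] holds uniformly and [is_derive_Rintegral] applies. *)
Lemma is_derive_fa_length I x y xi zeta c d : open I -> is_interval I ->
  smooth_on I x -> smooth_on I y -> smooth_on I xi -> smooth_on I zeta ->
  (forall u, I u -> adet x y u = 1) -> (forall u, I u -> 0 < bracket 2 3 x y u) ->
  I c -> I d -> c <= d ->
  is_derive (0 : R) (1 : R) (fun t => fa_length (fun u => x u + t * xi u)
                                (fun u => y u + t * zeta u) c d)
    (Rintegral mu `[c, d] (variation_density x y xi zeta)).
Proof.
move=> oI iI sx sy sxi szeta arc pos Ic Id cd.
pose k u := bracket 2 3 x y u.
pose a u := dbracket 1 2 x y xi zeta u.
pose b u := bracket 1 2 xi zeta u.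
pose p u := 4 / 3 * dbracket 2 3 x y xi zeta u + 1 / 3 * dbracket 1 4 x y xi zeta u.
pose q u := 4 / 3 * bracket 2 3 xi zeta u + 1 / 3 * bracket 1 4 xi zeta u.
pose b1 u := dbracket 1 3 x y xi zeta u.
pose b2 u := bracket 1 3 xi zeta u.
have sub := segment_sub iI Ic Id.
have bnd f : smooth_on I f -> {within `[c, d], continuous f}.
  by move=> sf; apply: (continuous_on_segment iI Ic Id); exact: smooth_on_continuous.
have [M M1 HM] : exists2 M, 1 <= M & forall u, u \in `[c, d] ->
    [/\ `|k u| <= M, `|a u| <= M, `|b u| <= M & `|p u| <= M] /\
    [/\ `|q u| <= M, `|b1 u| <= M & `|b2 u| <= M].
  pose g u := k u * k u + a u * a u + b u * b u + p u * p u + q u * q u +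
    b1 u * b1 u + b2 u * b2 u.
  have sg : smooth_on I g.
    by rewrite /g /k /a /b /p /q /b1 /b2 /bracket /dbracket; smooth.
  have [M HM] := bounded_on_segment (bnd _ sg).
  exists (1 + `|M|); first by rewrite lerDl.
  move=> u /HM /(le_trans (ler_norm _)) /le_trans/(_ (ler_norm M)).
  exact: norms_le.
have [m m0 km] : exists2 m, 0 < m & forall u, u \in `[c, d] -> m <= k u.
  have sk : smooth_on I k by rewrite /k /bracket; smooth.
  have [u0 u0cd H] := EVT_min cd (bnd _ sk).
  by exists (k u0) => //; apply: pos; exact: sub.
have [r r0 [C HC]] := element_expansion m0 M1.
have expand t u : `|t| <= r -> u \in `[c, d] -> _ := fun tr ucd =>
  let: conj (And4 h1 h2 h3 h4) (And3 h5 h6 h7) := HM u ucd in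
  HC (k u) (a u) (b u) (p u) (q u) (b1 u) (b2 u) t (km u ucd)
    h1 h2 h3 h4 h5 h6 h7 tr.
pose X t u := x u + t * xi u; pose Y t u := y u + t * zeta u.
have sX t : smooth_on I (X t) by rewrite /X; smooth.
have sY t : smooth_on I (Y t) by rewrite /Y; smooth.
have brE i j t u : I u -> bracket i j (X t) (Y t) u = bracket i j x y u +
    t * dbracket i j x y xi zeta u + t ^+ 2 * bracket i j xi zeta u.
  exact: bracket_variation.
(* Positivity of [1,2] for the varied curve is known on [[c, d]] only, while the formulas for the
   element need an open set: [J t] is one that contains the segment when t is small. *)
pose J t := [set u | I u /\ 0 < bracket 1 2 (X t) (Y t) u].
have oJ t : open (J t).
  apply: (open_pos oI) => u Iu.
  exact: (smooth_on_continuous (smooth_on_bracket oI (sX t) (sY t)) Iu).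
have JI t : J t `<=` I by move=> u [].
have Jcd t u : `|t| <= r -> u \in `[c, d] -> J t u.
  move=> tr ucd; split; first exact: sub.
  rewrite brE; last exact: sub.
  by rewrite [bracket 1 2 x y u]arc; [case: (expand t u tr ucd)|exact: sub].
have elE t u : `|t| <= r -> u \in `[c, d] -> fa_element (X t) (Y t) u =
    Num.sqrt ((k u + t * p u + t ^+ 2 * q u) / (1 + t * a u + t ^+ 2 * b u)
     - 5 / 9 * ((t * b1 u + t ^+ 2 * b2 u) / (1 + t * a u + t ^+ 2 * b u)) ^+ 2).
  move=> tr ucd; have Ju := Jcd t u tr ucd; have Iu := sub u ucd.
  rewrite (fa_elementE (oJ t) _ _ _ Ju); last by move=> v [].
  (* At t = 0 the values [1,2] = 1, [1,3] = 0 and [1,4] = - [2,3] leave (4/3 - 1/3) [2,3] =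
     kappa. *)
  - rewrite !brE // [bracket 1 2 x y u]arc // (bracket_arc13 oI sx sy arc Iu).
    rewrite (bracket_arc14 oI sx sy arc Iu) add0r.
    congr (Num.sqrt (_ / _ - _)).
    by rewrite /k /p /q; values u; field.
  - exact: smooth_on_sub (sX t).
  - exact: smooth_on_sub (sY t).
apply: (@is_derive_Rintegral _ _ _ (fun t => fa_element (X t) (Y t)) _ r C) => //.
- move=> t tr; apply: continuous_compact_integrable; first exact: segment_compact.
  apply: continuous_in_subspaceT => u; rewrite inE /= => ucd.
  apply: (fa_element_continuous (oJ t)) (Jcd t u tr ucd).
  + exact: smooth_on_sub (sX t).
  + exact: smooth_on_sub (sY t).
  + by move=> v [].
- apply: continuous_compact_integrable; first exact: segment_compact.
  exact/bnd/smooth_on_variation_density.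
- move=> t u tr ucd; rewrite (elE t u tr ucd).
  have -> : fa_element (X 0) (Y 0) u = Num.sqrt (k u).
    rewrite (elE 0 u _ ucd); last by rewrite normr0 ltW.
    by values u; rewrite expr0n /= !mul0r !addr0 mul0r expr0n mulr0 subr0 divr1.
  by case: (expand t u tr ucd).
Qed.

End ArcLengthVariation.

(** * Integration by parts *)

Section EulerLagrange.
Context {R : realType}.
Local Notation mu := (@lebesgue_measure R).
Implicit Types (I : set R) (f g w x y xi zeta : R -> R) (c d r t u C : R).

Lemma Rintegral_derive1 I f c d : open I -> is_interval I -> smooth_on I f ->
  I c -> I d -> c <= d -> Rintegral mu `[c, d] f^`() = f d - f c.
Proof.
move=> oI iI sf Ic Id; rewrite le_eqVlt => /orP[/eqP <-|cd].
  by rewrite set_itv1 Rintegral_set1 subrr.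
rewrite /Rintegral (@continuous_FTC2 _ _ f) //.
- apply: (continuous_on_segment iI Ic Id) => u Iu.
  exact: (smooth_on_continuous (smooth_on_derive1 sf) Iu).
- split=> [u ucd||].
  + by apply: (sf 0%N); apply: (segment_sub iI Ic Id); exact: subset_itv_oo_cc ucd.
  + by apply: cvg_at_right_filter; exact: (smooth_on_continuous sf Ic).
  + by apply: cvg_at_left_filter; exact: (smooth_on_continuous sf Id).
Qed.

(** The support condition is silent at the end points themselves. As [I] is open it contains points
    left of [c], and continuity carries the value 0 over. *)
Lemma vanishing_left_endpoint I f c : open I -> I c -> {for c, continuous f} ->
  (forall u, I u -> u < c -> f u = 0) -> f c = 0.
Proof.
move=> oI Ic cf f0; apply: (@cvg_unique _ _ (f x @[x --> c^'-])) => //.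
  exact: cvg_at_left_filter.
apply: cvg_near_cst; near=> u; apply: f0; last by near: u; exact: nbhs_left_lt.
by near: u; apply: cvg_within; exact: open_nbhs_nbhs.
Unshelve. all: by end_near. Qed.

Lemma vanishing_right_endpoint I f d : open I -> I d -> {for d, continuous f} ->
  (forall u, I u -> d < u -> f u = 0) -> f d = 0.
Proof.
move=> oI Id cf f0; apply: (@cvg_unique _ _ (f x @[x --> d^'+])) => //.
  exact: cvg_at_right_filter.
apply: cvg_near_cst; near=> u; apply: f0; last by near: u; exact: nbhs_right_gt.
by near: u; apply: cvg_within; exact: open_nbhs_nbhs.
Unshelve. all: by end_near. Qed.

Lemma derive1n_vanish (J : set R) f n : open J -> (forall u, J u -> f u = 0) ->
  forall u, J u -> f^`(n) u = 0.
Proof.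
move=> oJ f0 u Ju; rewrite (derive1n_ext_open n oJ f0 Ju).
elim: n u {Ju} => [//|n IHn] u; rewrite derive1nS.
have -> : (fun=> 0 : R)^`(n) = fun=> 0 by apply/funext.
exact: derive1_cst.
Qed.

(** With eta = (xi, zeta) this is |gamma^(i), eta^(j)|; [dbracket] is its antisymmetrization in i
    and j. *)
Definition cross (i j : nat) x y xi zeta u :=
  x^`(i) u * zeta^`(j) u - y^`(i) u * xi^`(j) u.

Lemma is_derive_cross I x y xi zeta i j : smooth_on I x -> smooth_on I y ->
  smooth_on I xi -> smooth_on I zeta -> forall u, I u ->
  is_derive u 1 (cross i j x y xi zeta)
    (cross i.+1 j x y xi zeta u + cross i j.+1 x y xi zeta u).
Proof.
move=> sx sy sxi szeta u Iu; rewrite /cross.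
derive_by.
by rewrite !derive1nS; values u; ring.
Qed.

(** In a unimodular frame (v1, v2), Cramer's rule reads v3 = - [2,3] v1 + [1,3] v2. *)
Let frame_identity (x1 x2 x3 y1 y2 y3 : R) : x1 * y2 - y1 * x2 = 1 ->
  x1 * y3 - y1 * x3 = 0 ->
  x3 = - (x2 * y3 - y2 * x3) * x1 /\ y3 = - (x2 * y3 - y2 * x3) * y1.
Proof.
move=> h12 h13; split.
  rewrite -[LHS]mulr1 -h12 -[LHS]subr0 -(mulr0 x2) -h13; ring.
rewrite -[LHS]mulr1 -h12 -[LHS]subr0 -(mulr0 y2) -h13; ring.
Qed.

Lemma arc_third_derivative I x y : open I -> smooth_on I x -> smooth_on I y ->
  (forall u, I u -> adet x y u = 1) -> forall u, I u ->
  x^`(3) u = - bracket 2 3 x y u * x^`(1) u /\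
  y^`(3) u = - bracket 2 3 x y u * y^`(1) u.
Proof.
move=> oI sx sy arc u Iu.
exact: frame_identity (arc u Iu) (bracket_arc13 oI sx sy arc Iu).
Qed.

Lemma arc_fourth_derivative I x y : open I -> smooth_on I x -> smooth_on I y ->
  (forall u, I u -> adet x y u = 1) -> forall u, I u ->
  x^`(4) u = - (bracket 2 3 x y)^`() u * x^`(1) u - bracket 2 3 x y u * x^`(2) u /\
  y^`(4) u = - (bracket 2 3 x y)^`() u * y^`(1) u - bracket 2 3 x y u * y^`(2) u.
Proof.
move=> oI sx sy arc u Iu.
have sk : smooth_on I (bracket 2 3 x y) by exact: smooth_on_bracket.
have tx v Iv := (arc_third_derivative oI sx sy arc (u := v) Iv).1.
have ty v Iv := (arc_third_derivative oI sx sy arc (u := v) Iv).2.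
have step f : smooth_on I f ->
    (forall v, I v -> f^`(3) v = - bracket 2 3 x y v * f^`(1) v) ->
    f^`(4) u = - (bracket 2 3 x y)^`() u * f^`(1) u - bracket 2 3 x y u * f^`(2) u.
  move=> sf tf; have df : is_derive u 1 (fun v => - bracket 2 3 x y v * f^`(1) v)
      (- (bracket 2 3 x y)^`() u * f^`(1) u + - bracket 2 3 x y u * f^`(1)^`() u).
    by deriv.
  rewrite -mulNr -(is_derive_derive1 df).
  exact: (@derive1_ext_open _ I f^`(3) _ oI tf u Iu).
by split; apply: step.
Qed.

(** Differentiate k w^2 = 1/4 and cancel w. *)
Lemma half_sqrtV_derivative I (k : R -> R)
    (w : R -> R := fun u => (2 * Num.sqrt (k u))^-1) :
  open I -> smooth_on I k -> (forall u, I u -> 0 < k u) ->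
  forall u, I u -> k^`() u * w u = - 2 * (k u * w^`() u).
Proof.
move=> oI sk pos u Iu; have sw : smooth_on I w by exact: smooth_on_half_sqrtV.
have kw v : I v -> k v * (w v * w v) = 1 / 4.
  move=> Iv; have s0 : 0 < Num.sqrt (k v) by rewrite sqrtr_gt0 pos.
  rewrite -{1}[k v]sqr_sqrtr ?ltW ?pos // /w.
  by field; rewrite gt_eqF.
have w0 : w u != 0.
  by rewrite invr_neq0 // mulf_neq0 // gt_eqF // sqrtr_gt0 pos.
apply: (mulIf w0); have := derive1_ext_open oI kw Iu; rewrite derive1_cst => h.
have dk : is_derive u 1 (fun u => k u * (w u * w u))
    (k^`() u * (w u * w u) + k u * (w^`() u * w u + w u * w^`() u)).
  by clearbody w; deriv.
rewrite (is_derive_derive1 dk) in h.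
by rewrite -[LHS]subr0 -h; values u; ring.
Qed.

(** Integration by parts done pointwise, with [W] collecting the boundary terms. It is linear in the
    derivatives of the variation field, hence vanishes where they all do. *)
Lemma variation_densityE I x y xi zeta
    (k : R -> R := bracket 2 3 x y)
    (w : R -> R := fun u => (2 * Num.sqrt (k u))^-1) :
  open I -> smooth_on I x -> smooth_on I y -> smooth_on I xi -> smooth_on I zeta ->
  (forall u, I u -> adet x y u = 1) -> (forall u, I u -> 0 < k u) ->
  exists2 W, smooth_on I W & forall u, I u ->
    variation_density x y xi zeta u =
      W^`() u + 1 / 3 * ((w^`(4) u + k u * w^`(2) u) * cross 1 0 x y xi zeta u) /\
    ((forall i, xi^`(i) u = 0 /\ zeta^`(i) u = 0) -> W u = 0).
Proof.
move=> oI sx sy sxi szeta arc pos.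
have sk : smooth_on I k by exact: smooth_on_bracket.
have sw : smooth_on I w by exact: smooth_on_half_sqrtV.
pose C i j : R -> R := cross i j x y xi zeta.
have sC i j : smooth_on I (C i j) by rewrite /C /cross; smooth.
have dC i j u : I u -> is_derive u 1 (C i j) (C i.+1 j u + C i j.+1 u).
  exact: is_derive_cross.
have dw i u Iu := smooth_on_is_derive (smooth_on_derive1n (n := i) sw) (u := u) Iu.
have kw' u : I u -> k^`() u * w u = - 2 * (k u * w^`() u).
  exact: half_sqrtV_derivative.
(* The primitive, with al = |eta,N|, be = |T,eta|, p = |eta',N|, v = |T,eta'|,
   T = gamma' and N = gamma'', is 2 w kappa v + (w v'' - w' v' + w'' v - w p' + w' p
   - w'' al - w''' be) / 3. *)
pose W (u : R) : R := 2 * w u * k u * C 1%N 1%N u + 1 / 3 * (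
  w u * (C 3%N 1%N u + 2 * C 2%N 2%N u + C 1%N 3%N u) -
  w^`(1) u * (C 2%N 1%N u + C 1%N 2%N u) + w^`(2) u * C 1%N 1%N u +
  w u * (C 3%N 1%N u + C 2%N 2%N u) - w^`(1) u * C 2%N 1%N u +
  w^`(2) u * C 2%N 0%N u - w^`(3) u * C 1%N 0%N u).
exists W.
  have ? := sC 1%N 1%N; have ? := sC 3%N 1%N; have ? := sC 2%N 2%N.
  have ? := sC 1%N 3%N; have ? := sC 2%N 1%N; have ? := sC 1%N 2%N.
  have ? := sC 2%N 0%N; have ? := sC 1%N 0%N.
  by clearbody C w k; rewrite /W; smooth.
move=> u Iu; split; last first.
  move=> z; have C0 i j : C i j u = 0.
    by rewrite /C /cross; have [-> ->] := z j; rewrite !mulr0 subr0.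
  by rewrite /W !C0; values u; ring.
(* By gamma''' = - kappa gamma', the third and fourth derivatives of the curve are traded for the
   first two. *)
have [x3 y3] := arc_third_derivative oI sx sy arc Iu.
have [x4 y4] := arc_fourth_derivative oI sx sy arc Iu.
have C3 j : C 3%N j u = - k u * C 1%N j u.
  by rewrite /C /cross x3 y3 -/(k u); values u; ring.
have C4 j : C 4%N j u = - k^`() u * C 1%N j u - k u * C 2%N j u.
  by rewrite /C /cross x4 y4 -/k; values u; ring.
have db i j : dbracket i j x y xi zeta u = C i j u - C j i u.
  by rewrite /dbracket /C /cross; values u; ring.
rewrite /variation_density !db -/(k u) -/(w u).
have dw0 : is_derive u 1 w (w^`(1) u) := dw 0%N u Iu.
have dw1 : is_derive u 1 w^`(1) (w^`(2) u) := dw 1%N u Iu.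
have dw2 : is_derive u 1 w^`(2) (w^`(3) u) := dw 2%N u Iu.
have dw3 : is_derive u 1 w^`(3) (w^`(4) u) := dw 3%N u Iu.
have dk : is_derive u 1 k (k^`() u) := smooth_on_is_derive sk Iu.
have d11 := dC 1%N 1%N u Iu; have d31 := dC 3%N 1%N u Iu.
have d22 := dC 2%N 2%N u Iu; have d13 := dC 1%N 3%N u Iu.
have d21 := dC 2%N 1%N u Iu; have d12 := dC 1%N 2%N u Iu.
have d20 := dC 2%N 0%N u Iu; have d10 := dC 1%N 0%N u Iu.
have {}kw' := kw' u Iu; rewrite -(derive1n1 w) in kw'.
rewrite -/(C 1%N 0%N).
have C3' := (C3 0%N, C3 1%N, C3 2%N); have C4' := C4 1%N.
clear C3 C4 x3 y3 x4 y4 sC dC dw sw sk pos.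
clearbody C w k.
eassert (dW : is_derive u 1 W _) by (rewrite /W; deriv).
rewrite (is_derive_derive1 dW) {dW}.
rewrite !C4' !C3'.
(* The two sides agree only modulo this relation; [C 1 1] times it is subtracted before [field]
   concludes. *)
have z : k^`() u * w u + 2 * (k u * w^`(1) u) = 0 by rewrite kw' mulNr addNr.
rewrite -[RHS]subr0 -[X in _ = _ - X](mulr0 (C 1%N 1%N u)) -[X in _ = _ - _ * X]z.
by clear; values u; field.
Qed.

Lemma support_derivatives I (f : R -> R) c d : open I ->
  (forall u, I u -> (u < c \/ d < u) -> f u = 0) ->
  forall n u, I u -> (u < c \/ d < u) -> f^`(n) u = 0.
Proof.
move=> oI f0 n u Iu ucd.
apply: (@derive1n_vanish (I `&` ([set v | v < c] `|` [set v | d < v]))).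
- by apply: openI => //; apply: openU; [exact: open_lt|exact: open_gt].
- by move=> v [Iv vcd]; exact: f0.
- by [].
Qed.

(** [W] vanishes on [I] outside the segment, hence by continuity at both ends, and its derivative
    integrates to 0. *)
Lemma Rintegral_variation_density I x y xi zeta c d
    (k : R -> R := bracket 2 3 x y)
    (w : R -> R := fun u => (2 * Num.sqrt (k u))^-1) :
  open I -> is_interval I ->
  smooth_on I x -> smooth_on I y -> smooth_on I xi -> smooth_on I zeta ->
  (forall u, I u -> adet x y u = 1) -> (forall u, I u -> 0 < k u) ->
  I c -> I d -> c <= d ->
  (forall u, I u -> (u < c \/ d < u) -> xi u = 0 /\ zeta u = 0) ->
  Rintegral mu `[c, d] (variation_density x y xi zeta) =
  Rintegral mu `[c, d] (fun u => 1 / 3 *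
    ((w^`(4) u + k u * w^`(2) u) * (x^`() u * zeta u - y^`() u * xi u))).
Proof.
move=> oI iI sx sy sxi szeta arc pos Ic Id cd supp.
have [W sW WE] := variation_densityE oI sx sy sxi szeta arc pos.
have sxi0 := support_derivatives oI (fun u Iu h => (supp u Iu h).1).
have szeta0 := support_derivatives oI (fun u Iu h => (supp u Iu h).2).
have W0 u : I u -> u < c \/ d < u -> W u = 0.
  move=> Iu ucd; apply: (WE u Iu).2 => i.
  by split; [exact: sxi0|exact: szeta0].
have Wc : W c = 0.
  apply: (vanishing_left_endpoint oI Ic (smooth_on_continuous sW Ic)) => u Iu uc.
  by apply: W0 => //; left.
have Wd : W d = 0.
  apply: (vanishing_right_endpoint oI Id (smooth_on_continuous sW Id)) => u Iu uc.
  by apply: W0 => //; right.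
have sk : smooth_on I k by exact: smooth_on_bracket.
have sw : smooth_on I w by exact: smooth_on_half_sqrtV.
set g := (X in _ = Rintegral _ _ X).
have sg : smooth_on I g by clearbody w k; rewrite /g; smooth.
have int f : smooth_on I f -> mu.-integrable `[c, d] (EFin \o f).
  move=> sf; apply: continuous_compact_integrable; first exact: segment_compact.
  by apply: (continuous_on_segment iI Ic Id); exact: smooth_on_continuous.
have -> : Rintegral mu `[c, d] (variation_density x y xi zeta) =
    Rintegral mu `[c, d] (fun u => W^`() u + g u).
  apply: eq_Rintegral => u; rewrite inE /= => ucd.
  exact: (WE u (segment_sub iI Ic Id ucd)).1.
rewrite RintegralD //; [|exact/int/smooth_on_derive1|exact: int].
by rewrite (Rintegral_derive1 oI iI sW Ic Id cd) Wc Wd subrr add0r.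
Qed.

End EulerLagrange.

(** * Bump functions *)

Section Bump.
Context {R : realType}.
Implicit Types (P : {poly R}) (I : set R) (a c d r s u x y : R).

(* The functions P(1/x) exp(-1/x), extended by 0, are stable under derivation. *)
Definition flat P x := if 0 < x then P.[x^-1] * expR (- x^-1) else 0.

Lemma flat_le0 P x : x <= 0 -> flat P x = 0.
Proof. by rewrite /flat leNgt => /negbTE ->. Qed.

Lemma flat_gt0 P x : 0 < x -> flat P x = P.[x^-1] * expR (- x^-1).
Proof. by rewrite /flat => ->. Qed.

Lemma horner_bound P y : 1 <= y ->
  `|P.[y]| <= (\sum_(i < size P) `|P`_i|) * y ^+ size P.
Proof.
move=> y1; have y0 : 0 <= y by exact: le_trans y1.
rewrite horner_coef mulr_suml; apply: le_trans (ler_norm_sum _ _ _) _.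
apply: ler_sum => i _; rewrite normrM ler_wpM2l // ger0_norm ?exprn_ge0 //.
by rewrite ler_weXn2l // ltnW.
Qed.

(** With y = 1/x and n the size of P, exp y exceeds y^(n+2) / (n+2)!, which beats P(y) with y^2 to
    spare. The quadratic bound yields the zero derivative at 0. *)
Lemma flat_bound P : exists2 C, 0 <= C &
  forall x, `|x| <= 1 -> `|flat P x| <= C * x ^+ 2.
Proof.
pose n := size P; pose B := \sum_(i < size P) `|P`_i|.
have B0 : 0 <= B by exact: sumr_ge0.
exists (B * (n.+2)`!%:R); first by rewrite mulr_ge0.
move=> x x1; case: (ltP 0 x) => x0; last first.
  by rewrite flat_le0 // normr0 mulr_ge0 ?sqr_ge0 // mulr_ge0.
have y1 : 1 <= x^-1 by rewrite invf_ge1 // (le_trans (ler_norm x)).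
have y0 : 0 < x^-1 by rewrite invr_gt0.
set y := x^-1 in y1 y0 *.
have -> : x ^+ 2 = y ^- 2 by rewrite /y exprVn invrK.
have e0 : 0 < expR y by exact: expR_gt0.
rewrite flat_gt0 // -/y normrM (ger0_norm (expR_ge0 _)) expRN ler_pdivrMr //.
apply: le_trans (horner_bound P y1) _; rewrite -/B -/n -!mulrA ler_wpM2l //.
have fact_gt : 0 < (n.+2)`!%:R :> R by rewrite ltr0n fact_gt0.
rewrite mulrCA mulrC ler_pdivlMr ?exprn_gt0 // -exprD addn2 mulrC -ler_pdivrMr //.
have := expR_ge1Dxn n.+1 (ltW y0); lra.
Qed.

(** For y = 1/x one has d/dx = - y^2 d/dy, which sends P(y) exp(-y) to y^2 (P - P')(y) exp(-y). *)
Lemma is_derive_flat P x :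
  is_derive x 1 (flat P) (flat ('X^2 * (P - poly.deriv P)) x).
Proof.
have [x0|x0|->] := ltgtP x 0.
- rewrite flat_le0 ?(ltW x0) //.
  apply: (@near_eq_is_derive _ _ _ (cst 0)).
    by near=> v; rewrite /= flat_le0 // ltW //; near: v; exact: lt_nbhsl.
- have nx : x != 0 by rewrite gt_eqF.
  have di : is_derive x 1 (fun v : R => v^-1) (- 1 * x^-1 * x^-1).
    exact: (is_derive_lamV (f := id) nx (is_derive_id _ _)).
  have dp : is_derive x 1 (fun v => P.[v^-1])
      ((poly.deriv P).[x^-1] * (- 1 * x^-1 * x^-1)).
    exact: (is_derive1_comp (f := horner P) (is_derive_poly _ _) di).
  have de : is_derive x 1 (fun v => expR (- v^-1))
      (expR (- x^-1) * - (- 1 * x^-1 * x^-1)).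
    exact: (is_derive1_comp (f := expR) (is_derive_expR _) (is_derive_lamN di)).
  have near_flat : \forall v \near x, P.[v^-1] * expR (- v^-1) = flat P v.
    by near=> v; rewrite flat_gt0 //; near: v; exact: lt_nbhsr.
  apply: is_derive_congr (near_eq_is_derive near_flat (is_derive_lamM dp de)) _.
  rewrite flat_gt0 // hornerM hornerXn hornerD hornerN.
  by ring.
- rewrite flat_le0 //.
  have [C C0 HC] := flat_bound P.
  have lim : (h^-1 *: (flat P (h *: (1 : R) + 0) - flat P 0)) @[h --> 0^']
      --> (0 : R).
    apply/cvgrPdist_le => /= eps eps0; near=> h.
    have h0 : h != 0 by near: h; exact: nbhs_dnbhs_neq.
    have h1 : `|h| <= 1 by near: h; apply: dnbhs0_le.
    have he : `|h| <= eps / (C + 1).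
      by near: h; apply: dnbhs0_le; rewrite divr_gt0 // ltr_wpDl.
    rewrite /GRing.scale /= mulr1 addr0 [flat P 0]flat_le0 // subr0 sub0r normrN.
    rewrite normrM normfV ler_pdivrMl ?normr_gt0 //.
    apply: le_trans (HC h h1) _.
    rewrite -[h ^+ 2]real_normK ?num_real // expr2 mulrCA ler_wpM2l //.
    move: he; rewrite ler_pdivlMr ?ltr_wpDl // => he.
    by have : 0 <= `|h| by []; nra.
  by split; [apply/cvg_ex; exists (0 : R) | exact: cvg_lim].
Unshelve. all: by end_near. Qed.

Lemma smooth_on_flat_affine I P a s : open I ->
  smooth_on I (fun u => flat P (a + s * u)).
Proof.
move=> oI.
(* The scalar [r] absorbs the factor [s] that the chain rule produces at each derivation. *)
apply: (@smooth_on_closed_class _ I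
  (fun f => exists r P, f = fun u => r * flat P (a + s * u)) oI); last first.
  by exists 1, P; apply/funext => u; rewrite mul1r.
move=> _ [r [Q ->]].
have df u : is_derive u 1 (fun u => r * flat Q (a + s * u))
    (r * s * flat ('X^2 * (Q - poly.deriv Q)) (a + s * u)).
  have dl : is_derive u 1 (fun u => a + s * u) s.
    have di := is_derive_id u (1 : R).
    have h := is_derive_lamD (is_derive_cst a u 1)
      (is_derive_lamM (is_derive_cst s u 1) di).
    by apply: is_derive_congr h _; rewrite /cst /=; ring.
  have dc := is_derive1_comp (f := flat Q) (g := fun u => a + s * u)
    (is_derive_flat Q (a + s * u)) dl.
  apply: is_derive_congr (is_derive_lamM (is_derive_cst r u 1) dc) _.
  by rewrite /cst /=; ring.
split; first by move=> u _; case: (df u).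
exists (fun u => r * s * flat ('X^2 * (Q - poly.deriv Q)) (a + s * u)).
  by exists (r * s), ('X^2 * (Q - poly.deriv Q)).
by move=> u _; exact: is_derive_derive1.
Qed.

Lemma bump_function I c d : open I -> exists2 b : R -> R, smooth_on I b &
  [/\ forall u, 0 <= b u, forall u, c < u < d -> 0 < b u &
    forall u, u < c \/ d < u -> b u = 0].
Proof.
(* On (c, d) this is exp(-1/(u-c)) exp(-1/(d-u)), with arguments in the shape [a + s * u]. *)
move=> oI; pose b u := flat 1 (- c + 1 * u) * flat 1 (d + - 1 * u).
have s1 : smooth_on I (fun u => flat 1 (- c + 1 * u)).
  exact: smooth_on_flat_affine.
have s2 : smooth_on I (fun u => flat 1 (d + - 1 * u)).
  exact: smooth_on_flat_affine.
exists b; first exact: (smooth_onM oI s1 s2).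
have flat1_ge0 v : 0 <= flat 1 v.
  have [v0|v0] := leP v 0; first by rewrite flat_le0.
  by rewrite flat_gt0 // hornerC mul1r expR_ge0.
split=> [u|u /andP[cu ud]|u ucd]; rewrite /b.
  exact: mulr_ge0.
  by rewrite !flat_gt0 ?hornerC ?mul1r ?mulr_gt0 ?expR_gt0 //; lra.
by case: ucd => ?; [rewrite flat_le0 ?mul0r|rewrite mulrC flat_le0 ?mul0r] => //;
  lra.
Qed.

End Bump.

(** * Critical curves *)

Section CriticalCurves.
Context {R : realType}.
Local Notation mu := (@lebesgue_measure R).
Implicit Types (I : set R) (f x y : R -> R) (c d u v : R).

Lemma zero_derivative_constant I f : is_interval I -> smooth_on I f ->
  (forall u, I u -> f^`() u = 0) -> forall u v, I u -> I v -> f u = f v.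
Proof.
move=> iI sf f0; suff le u v : I u -> I v -> u <= v -> f u = f v.
  move=> u v Iu Iv; case: (leP u v) => [uv|/ltW vu]; first exact: le.
  by symmetry; exact: le.
move=> Iu Iv uv; have sub := segment_sub iI Iu Iv.
have [||w wuv] := @MVT_segment R f f^`() u v uv.
- move=> w wuv; apply: (smooth_on_is_derive sf); apply: sub.
  exact: subset_itv_oo_cc wuv.
- by apply: (continuous_on_segment iI Iu Iv); exact: smooth_on_continuous.
- by rewrite f0 ?mul0r; [move/eqP; rewrite subr_eq0 => /eqP ->|exact: sub].
Qed.

(** By continuity [f] exceeds [f u / 2] on a short segment around [u], and nonnegativity makes the
    integral over it a lower bound. *)
Lemma Rintegral_gt0 I f c d u : is_interval I -> I c -> I d ->
  (forall v, I v -> {for v, continuous f}) -> (forall v, I v -> 0 <= f v) ->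
  c < u < d -> 0 < f u -> 0 < Rintegral mu `[c, d] f.
Proof.
move=> iI Ic Id cf f0 /andP[cu ud] fu.
have Iu : I u by apply: (iI c d) => //; rewrite !ltW.
have : \forall v \near u, f u / 2 < f v.
  by apply: (cf u Iu [set z | f u / 2 < z]); apply: lt_nbhsr; lra.
have nc : \forall v \near u, c < v by exact: lt_nbhsr.
have nd : \forall v \near u, v < d by exact: lt_nbhsl.
move=> nf; have [e /= e0 He] := filterI (filterI nc nd) nf.
(* Half the radius keeps the closed segment inside the open ball. *)
pose c1 := u - e / 2; pose d1 := u + e / 2.
have sub1 v : v \in `[c1, d1] -> (c < v /\ v < d) /\ f u / 2 < f v.
  rewrite in_itv /= => /andP[h1 h2]; apply: He.
  by rewrite /= ltr_norml /c1 /d1 in h1 h2 *; apply/andP; split; lra.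
have c1d1 : c1 < d1 by rewrite /c1 /d1; lra.
have [[cc1 _] _] : (c < c1 /\ c1 < d) /\ f u / 2 < f c1.
  by apply: sub1; rewrite in_itv /= lexx ltW.
have [[_ d1d] _] : (c < d1 /\ d1 < d) /\ f u / 2 < f d1.
  by apply: sub1; rewrite in_itv /= lexx ltW.
have cd : c <= d by lra.
have int a b : I a -> I b -> mu.-integrable `[a, b] (EFin \o f).
  move=> Ia Ib; apply: continuous_compact_integrable; first exact: segment_compact.
  exact: (continuous_on_segment iI Ia Ib).
have Ic1 : I c1 by apply: (iI c d) => //; apply/andP; split; lra.
have Id1 : I d1 by apply: (iI c d) => //; apply/andP; split; lra.
have h1 : f u / 2 * (d1 - c1) <= Rintegral mu `[c1, d1] f.
  have <- : Rintegral mu `[c1, d1] (fun=> f u / 2) = f u / 2 * (d1 - c1).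
    by rewrite Rintegral_cst //= lebesgue_measure_itv /= lte_fin c1d1.
  apply: le_Rintegral => //; last by move=> v /sub1[_ /ltW].
  - apply: continuous_compact_integrable; first exact: segment_compact.
    by apply: continuous_subspaceT => ?; exact: cst_continuous.
  - exact: int.
have h2 : Rintegral mu `[c1, d1] f <= Rintegral mu `[c, d] f.
  apply: fine_le; [exact: integrable_fin_num (int _ _ Ic1 Id1)|
    exact: integrable_fin_num (int _ _ Ic Id)|].
  apply: ge0_subset_integral => //.
  - by have /integrableP[] := int _ _ Ic Id.
  - by move=> v vcd; rewrite lee_fin f0 //; exact: (segment_sub iI Ic Id).
  - move=> v /=; rewrite !in_itv /= => /andP[h2 h3].
    by apply/andP; split; lra.
apply: lt_le_trans (le_trans h1 h2); apply: mulr_gt0; first by lra.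
by rewrite subr_gt0.
Qed.

(** * The Euler-Lagrange equation in equi-affine parametrization *)

Section UnitSpeed.
Context (I : set R) (x y : R -> R) (oI : open I) (iI : is_interval I).
Context (sx : smooth_on I x) (sy : smooth_on I y).
Context (arc : forall u, I u -> adet x y u = 1).
Let k : R -> R := bracket 2 3 x y.
Context (pos : forall u, I u -> 0 < k u).
Let w : R -> R := fun u => (2 * Num.sqrt (k u))^-1.

Let sk : smooth_on I k. Proof. exact: smooth_on_bracket. Qed.

Let sw : smooth_on I w. Proof. exact: smooth_on_half_sqrtV. Qed.

(** Since k^(3/2) = k sqrt k, the full-affine curvature is k' w / k, and k' w = - 2 k w'. *)
Lemma fa_curvE u : I u -> fa_curv x y u = - 2 * w^`() u.
Proof.
move=> Iu; have ke := ea_kappa_arc oI sx sy arc.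
rewrite /fa_curv /sD (derive1_ext_open oI ke Iu) ke // arc // powR1 divr1 -/(k u).
have k0 := pos Iu; have s0 : 0 < Num.sqrt (k u) by rewrite sqrtr_gt0.
have -> : k u `^ (3 / 2) = k u * Num.sqrt (k u).
  have -> : 3 / 2 = 1 + 2^-1 :> R by lra.
  by rewrite powRD ?gt_eqF ?implybT // powRr1 ?powR12_sqrt // ltW.
have kw' : k^`() u * w u = - 2 * (k u * w^`() u).
  exact: (half_sqrtV_derivative (k := k) oI).
have k0' : k u != 0 by rewrite gt_eqF.
have -> : - 2 * w^`() u = k^`() u * w u / k u.
  by apply: (mulIf k0'); rewrite divfK // kw'; values u; ring.
by rewrite /w; field; rewrite k0' gt_eqF.
Qed.

(** The equation says that w'' solves z'' = - k z, so it is a combination of x' and y'; one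
    integration gives w', and the factor -2 gives kappa_F. *)
Lemma Euler_Lagrange_affine : I !=set0 ->
  (forall u, I u -> w^`(4) u + k u * w^`(2) u = 0) <->
  exists A B C, forall u, I u -> fa_curv x y u = A * x u + B * y u + C.
Proof.
move=> [u0 Iu0].
have dx i u : I u -> is_derive u 1 x^`(i) (x^`(i.+1) u).
  exact: (smooth_on_is_derive (smooth_on_derive1n sx)).
have dy i u : I u -> is_derive u 1 y^`(i) (y^`(i.+1) u).
  exact: (smooth_on_is_derive (smooth_on_derive1n sy)).
split=> [EL|[A [B [C HC]]] u Iu].
  (* The Wronskians of w'' with y' and x'. Both are constant, and as x' and y' have Wronskian 1 they
     are the coordinates of w'' in that basis. *)
  pose a (u : R) : R := w^`(2) u * y^`(2) u - w^`(3) u * y^`(1) u.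
  pose b (u : R) : R := x^`(1) u * w^`(3) u - x^`(2) u * w^`(2) u.
  have dw i u : I u -> is_derive u 1 w^`(i) (w^`(i.+1) u).
    exact: (smooth_on_is_derive (smooth_on_derive1n sw)).
  have sa : smooth_on I a by clearbody w; rewrite /a; smooth.
  have sb : smooth_on I b by clearbody w; rewrite /b; smooth.
  have a' u : I u -> a^`() u = 0.
    move=> Iu; have d2 := dw 2%N u Iu; have d3 := dw 3%N u Iu.
    have y2 := dy 2%N u Iu; have y1 := dy 1%N u Iu.
    rewrite /a; derive1_by.
    rewrite (arc_third_derivative oI sx sy arc Iu).2 -/(k u).
    move/eqP: (EL u Iu); rewrite addr_eq0 => /eqP ->.
    by values u; ring.
  have b' u : I u -> b^`() u = 0.
    move=> Iu; have d2 := dw 2%N u Iu; have d3 := dw 3%N u Iu.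
    have x2 := dx 2%N u Iu; have x1 := dx 1%N u Iu.
    rewrite /b; derive1_by.
    rewrite (arc_third_derivative oI sx sy arc Iu).1 -/(k u).
    move/eqP: (EL u Iu); rewrite addr_eq0 => /eqP ->.
    by values u; ring.
  have w2 u : I u -> w^`(2) u = a u0 * x^`(1) u + b u0 * y^`(1) u.
    move=> Iu; rewrite (zero_derivative_constant iI sa a' Iu0 Iu).
    rewrite (zero_derivative_constant iI sb b' Iu0 Iu) /a /b.
    rewrite -[LHS]mulr1 -(arc Iu) /adet -derive1n1 -(derive1n1 y).
    by values u; ring.
  (* Its constant value is the constant of integration. *)
  pose D (u : R) : R := w^`(1) u - a u0 * x u - b u0 * y u.
  have sD : smooth_on I D by clearbody w a b; rewrite /D; smooth.
  have D' u : I u -> D^`() u = 0.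
    move=> Iu; have d1 := dw 1%N u Iu.
    have y0 : is_derive u 1 y (y^`(1) u) := dy 0%N u Iu.
    have x0 : is_derive u 1 x (x^`(1) u) := dx 0%N u Iu.
    rewrite /D; derive1_by.
    by rewrite (w2 u Iu); move: (a u0) (b u0) => ? ?; values u; ring.
  exists (- 2 * a u0), (- 2 * b u0), (- 2 * D u0) => u Iu.
  rewrite (fa_curvE Iu) (zero_derivative_constant iI sD D' Iu0 Iu) /D derive1n1.
  by move: (a u0) (b u0) => ? ?; values u; ring.
have w1 v : I v -> w^`(1) v = - (1 / 2) * (A * x v + B * y v + C).
  by move=> Iv; rewrite -(HC v Iv) (fa_curvE Iv) derive1n1; values v; field.
have w2 v : I v -> w^`(2) v = - (1 / 2) * (A * x^`(1) v + B * y^`(1) v).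
  move=> Iv; rewrite derive1nS (@derive1_ext_open _ I w^`(1) _ oI w1 v Iv).
  derive1_by.
  by rewrite !derive1n1; values v; ring.
have w3 v : I v -> w^`(3) v = - (1 / 2) * (A * x^`(2) v + B * y^`(2) v).
  move=> Iv; rewrite derive1nS (@derive1_ext_open _ I w^`(2) _ oI w2 v Iv).
  have x1 := dx 1%N v Iv; have y1 := dy 1%N v Iv.
  by derive1_by; values v; ring.
have w4 : w^`(4) u = - (1 / 2) * (A * x^`(3) u + B * y^`(3) u).
  rewrite derive1nS (@derive1_ext_open _ I w^`(3) _ oI w3 u Iu).
  have x2 := dx 2%N u Iu; have y2 := dy 2%N u Iu.
  by derive1_by; values u; ring.
have [x3 y3] := arc_third_derivative oI sx sy arc Iu.
by rewrite w4 x3 y3 (w2 u Iu) -/(k u); values u; ring.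
Qed.

(** The reverse direction is immediate from the integral formula; the forward one is the fundamental
    lemma of the calculus of variations, near a point where [E] is non-zero. *)
Lemma critical_Euler_Lagrange :
  (forall (xi zeta : R -> R) (c d : R),
      smooth_on I xi -> smooth_on I zeta -> I c -> I d ->
      (forall u, I u -> (u < c \/ d < u) -> xi u = 0 /\ zeta u = 0) ->
      is_derive (0 : R) (1 : R)
        (fun t : R => fa_length (fun u => x u + t * xi u)
                                (fun u => y u + t * zeta u) c d) 0) <->
  (forall u, I u -> w^`(4) u + k u * w^`(2) u = 0).
Proof.
pose E (u : R) : R := w^`(4) u + k u * w^`(2) u.
have sE : smooth_on I E.
  by have := sw; have := sk; clearbody w k => *; rewrite /E; smooth.
split=> [crit u0 Iu0|EL xi zeta c d sxi szeta Ic Id supp]; last first.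
  have [cd|dc] := leP c d.
    have := is_derive_fa_length oI iI sx sy sxi szeta arc pos Ic Id cd.
    rewrite (Rintegral_variation_density oI iI sx sy) // -/k -/w.
    rewrite (@eq_Rintegral _ _ _ _ _ (fun=> 0)) => [|u].
      by rewrite Rintegral_cst // mul0r.
    rewrite inE /= => ucd.
    by rewrite EL ?mul0r ?mulr0 //; exact: (segment_sub iI Ic Id ucd).
  (* For d < c the segment is empty and the length is constantly 0. *)
  have -> : (fun t : R => fa_length (fun u => x u + t * xi u)
      (fun u => y u + t * zeta u) c d) = cst 0.
    apply/funext => t; rewrite /fa_length set_itv_ge ?Rintegral_set0 //.
    by rewrite bnd_simp -ltNge.
  exact: is_derive_cst.
apply/eqP; rewrite -/(E u0); apply: contraT => E0.
have : \forall v \near u0, I v by exact: open_nbhs_nbhs.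
move=> [e /= e0 He].
pose c := u0 - e / 2; pose d := u0 + e / 2.
have Ic : I c by apply: He; rewrite /= /c opprB addrC subrK ger0_norm; lra.
have Id : I d by apply: He; rewrite /= /d opprD addNKr normrN ger0_norm; lra.
have cud : c < u0 < d by apply/andP; split; rewrite /c /d; lra.
have [b sb [bge0 b0 bz]] := bump_function c d oI.
(* For eta = b E gamma'' one gets |gamma', eta| = b E, so the integrand becomes b E^2 / 3,
   nonnegative and positive at [u0]. *)
pose xi (u : R) : R := b u * E u * x^`(2) u.
pose zeta (u : R) : R := b u * E u * y^`(2) u.
have sxi : smooth_on I xi by clearbody E; rewrite /xi; smooth.
have szeta : smooth_on I zeta by clearbody E; rewrite /zeta; smooth.
have supp u : I u -> u < c \/ d < u -> xi u = 0 /\ zeta u = 0.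
  by move=> _ /bz bu; split; rewrite /xi /zeta bu -mulrA mul0r.
have cd : c <= d by rewrite /c /d; lra.
have d0 := crit xi zeta c d sxi szeta Ic Id supp.
have dL := is_derive_fa_length oI iI sx sy sxi szeta arc pos Ic Id cd.
have : Rintegral mu `[c, d] (variation_density x y xi zeta) = 0.
  by rewrite -(is_derive_derive1 dL) (is_derive_derive1 d0).
rewrite (Rintegral_variation_density oI iI sx sy) // -/k -/w.
pose g (u : R) : R := 1 / 3 * (b u * (E u * E u)).
rewrite (_ : Rintegral _ _ _ = Rintegral mu `[c, d] g) => [int0|]; last first.
  apply: eq_Rintegral => u; rewrite inE /= => ucd.
  have Iu := segment_sub iI Ic Id ucd.
  rewrite /g -/(E u) /xi /zeta -[in RHS](mulr1 (b u)) -(arc Iu) /adet.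
  by values u; ring.
have sg : smooth_on I g by clearbody E; rewrite /g; smooth.
have := @Rintegral_gt0 I g c d u0 iI Ic Id _ _ cud _.
rewrite int0 ltxx; apply.
- by move=> v Iv; exact: (smooth_on_continuous sg Iv).
- by move=> v _; rewrite /g mulr_ge0 // mulr_ge0 // -expr2 sqr_ge0.
- by rewrite /g mulr_gt0 // mulr_gt0 ?b0 // -expr2 exprn_even_gt0.
Qed.

End UnitSpeed.

End CriticalCurves.

Unset Implicit Arguments.

(** Criticality makes kappa_F an affine function of the position; the alternatives correspond to its
    linear part being zero or not. *)
Theorem theorem6 (R : realType) (I : set R) (x y : R -> R)
  (hIo : open I) (hIi : is_interval I) (hIn : I !=set0)
  (hx : smooth_on I x) (hy : smooth_on I y)
  (harc : forall u, I u -> adet x y u = 1)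
  (hpos : forall u, I u -> 0 < ea_kappa x y u) :
  (forall (xi zeta : R -> R) (c d : R),
      smooth_on I xi -> smooth_on I zeta -> I c -> I d ->
      (forall u, I u -> (u < c \/ d < u) -> xi u = 0 /\ zeta u = 0) ->
      is_derive (0 : R) (1 : R)
        (fun t : R => fa_length (fun u => x u + t * xi u)
                                (fun u => y u + t * zeta u) c d) 0)
  <->
  ((exists C : R, forall u, I u -> fa_curv x y u = C) \/
   (exists A B x0 y0 : R, (A, B) != (0, 0) /\
      forall u, I u -> fa_curv x y u = A * (x u - x0) + B * (y u - y0))).
Proof.
have pos u : I u -> 0 < bracket 2 3 x y u.
  by move=> Iu; rewrite -(ea_kappa_arc hIo hx hy harc Iu); exact: hpos.
apply: iff_trans (critical_Euler_Lagrange hIo hIi hx hy harc pos) _.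
apply: iff_trans (Euler_Lagrange_affine hIo hIi hx hy harc pos hIn) _.
split=> [[A [B [C H]]]|[[C H]|[A [B [x0 [y0 [_ H]]]]]]].
- have [[A0 B0]|AB] := eqVneq (A, B) (0, 0).
    by left; exists C => u Iu; rewrite H // A0 B0 !mul0r !add0r.
  right; have n0 : A ^+ 2 + B ^+ 2 != 0.
    apply: contra AB; rewrite paddr_eq0 ?sqr_ge0 // !sqrf_eq0.
    by move=> /andP[/eqP -> /eqP ->].
  (* The new origin is the foot of the perpendicular from the old one to the line A x + B y + C = 0,
     so that A x0 + B y0 = - C. *)
  exists A, B, (- C * A / (A ^+ 2 + B ^+ 2)), (- C * B / (A ^+ 2 + B ^+ 2)).
  split=> // u Iu; rewrite H //.
  by move: n0; values u => n0; field.
- by exists 0, 0, C => u Iu; rewrite H // !mul0r !add0r.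
- exists A, B, (- A * x0 - B * y0) => u Iu; rewrite H //.
  by values u; ring.
Qed.
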